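(* Let $H$ be an infinite-dimensional Hilbert space. If $B(H)\cong C_r^*(G,\Sigma)$ (as $C^*$-algebras) for some locally compact Hausdorff étale groupoid $G$ and some twist $\Sigma$ over $G$, then the unit space $G^{(0)}$ is not finite.
   Context: $B(H)$ is the $C^*$-algebra of all bounded operators on $H$. A locally compact Hausdorff étale groupoid $G$ is a topological groupoid with locally compact Hausdorff topology whose range and source maps $r,s:G\to G^{(0)}$ are local homeomorphisms. Write $G^u=r^{-1}(u)$, $G_u=s^{-1}(u)$. A twist over $G$ is a central extension of topological groupoids $G^{(0)}\times\mathbb T\xrightarrow{\iota}\Sigma\xrightarrow{q}G$, where $\mathbb T$ is the unit circle, $\Sigma$ is a locally compact Hausdorff groupoid with unit space identified with $G^{(0)}$, $\iota$ is a homeomorphism onto $q^{-1}(G^{(0)})$, $q$ is a continuous open surjective groupoid homomorphism, $\iota(r(\varsigma),z)\varsigma=\varsigma\,\iota(s(\varsigma),z)=:z\varsigma$ for all $\varsigma\in\Sigma$, $z\in\mathbb T$ (centrality), and $\Sigma\to G$ is a locally trivial principal $\mathbb T$-bundle. $C_c(G,\Sigma)$ is the $*$-algebra of continuous compactly supported functions $f:\Sigma\to\mathbb C$ with $f(z\varsigma)=zf(\varsigma)$ for $z\in\mathbb T$ (sections of the associated line bundle over $G$), with product $(f*g)(\varsigma)=\sum_{q(\tau)\in G^{r(\varsigma)}}f(\tau)g(\tau^{-1}\varsigma)$ (one representative $\tau\in\Sigma$ for each element of $G^{r(\varsigma)}$) and involution $f^*(\varsigma)=\overline{f(\varsigma^{-1})}$.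 For $u\in G^{(0)}$, let $\ell^2(G_u,\Sigma_u)$ be the Hilbert space of functions $h:q^{-1}(G_u)\to\mathbb C$ with $h(z\varsigma)=zh(\varsigma)$ and $\sum_{q(\varsigma)\in G_u}|h(\varsigma)|^2<\infty$; the regular representation $\lambda_u$ of $C_c(G,\Sigma)$ on it is $\lambda_u(f)h=f*h$. The reduced twisted groupoid $C^*$-algebra $C_r^*(G,\Sigma)$ is the completion of $C_c(G,\Sigma)$ in the norm $\|f\|_r=\sup_{u\in G^{(0)}}\|\lambda_u(f)\|$. *)

(* Defs.v *)
From HB Require Import structures.
From mathcomp Require Import all_boot all_order all_algebra.
From mathcomp Require Import sesquilinear complex.
From mathcomp Require Import all_classical all_reals all_analysis.
From mathcomp Require Import ring lra.
Set Implicit Arguments. Unset Strict Implicit. Unset Printing Implicit Defensive.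
Import Order.TTheory GRing.Theory Num.Theory.
Import numFieldNormedType.Exports.
Local Open Scope classical_set_scope.
Local Open Scope complex_scope.
Local Open Scope ring_scope.

(* R[i] is only a numClosedFieldType in real_closed; its usual topology, the one
   induced by the modulus, is that of the normed module R[i]^o. *)
HB.instance Definition _ (R : realType) := NormedModule.copy R[i] R[i]^o.

(* hdot is linear in its first argument. *)
HB.mixin Record isHilbert (R : realType) H of CompleteNormedModule R[i] H := {
  hdot : {dot H for (@Num.conj R[i])};
  hdotxx : forall x : H, hdot x x = `|x| ^+ 2
}.
#[short(type="hilbertType")]
HB.structure Definition Hilbert (R : realType) :=
  {H of isHilbert R H & CompleteNormedModule R[i] H}.

Definition infinite_dimensional (K : fieldType) (V : lmodType K) :=
  ~ exists (n : nat) (e : 'I_n -> V),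
      forall v, exists c : 'I_n -> K, v = \sum_i c i *: e i.

Section RieszRepresentation.
Context {R : realType} {H : hilbertType R}.
Implicit Types x y z : H.
Local Notation "'[ x , y ]" := (hdot x y).

Lemma hdotC x y : '[x, y] = ('[y, x])^*%C.
Proof. by rewrite (hermC (hdot : {dot H for _})) expr0 mul1r. Qed.
Lemma hdotDl x y z : '[x + y, z] = '[x, z] + '[y, z].
Proof. exact: linearDl. Qed.
Lemma hdotZl (c : R[i]) x y : '[c *: x, y] = c * '[x, y].
Proof. exact: linearZl_LR. Qed.
Lemma hdotDr x y z : '[x, y + z] = '[x, y] + '[x, z].
Proof. exact: linearDr. Qed.
Lemma hdotZr (c : R[i]) x y : '[x, c *: y] = c^*%C * '[x, y].
Proof. exact: linearZr_LR. Qed.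

Let nr x : R := complex.Re `|x|.
Let nrE x : `|x| = (nr x)%:C.
Proof. by rewrite RRe_real// normr_real. Qed.
Let nr_ge0 x : 0 <= nr x. Proof. by rewrite -ler0c -nrE. Qed.
Let nrD x y : nr (x + y) <= nr x + nr y.
Proof. by rewrite -lecR rmorphD/= -!nrE ler_normD. Qed.

Let rd x y : R := complex.Re '[x, y].
Let rdxx x : rd x x = nr x ^+ 2.
Proof. by rewrite /rd hdotxx nrE -rmorphXn. Qed.
Let rdC x y : rd x y = rd y x.
Proof. by rewrite /rd hdotC; case: '[y, x]. Qed.
Let rdDl x y z : rd (x + y) z = rd x z + rd y z.
Proof. by rewrite /rd hdotDl raddfD. Qed.
Let rdZl (t : R) x y : rd (t%:C *: x) y = t * rd x y.
Proof. by rewrite /rd hdotZl; case: '[x, y] => a b /=; rewrite mul0r subr0. Qed.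
Let rdDr x y z : rd z (x + y) = rd z x + rd z y.
Proof. by rewrite !(rdC z) rdDl. Qed.
Let rdZr (t : R) x y : rd y (t%:C *: x) = t * rd y x.
Proof. by rewrite !(rdC y) rdZl. Qed.
Let rd_le x y : rd x y <= nr x * nr y.
Proof.
have xy0 : 0 <= nr (x + y) by exact: nr_ge0.
have : nr (x + y) ^+ 2 <= (nr x + nr y) ^+ 2.
  by rewrite lerXn2r ?nnegrE ?addr_ge0 ?nr_ge0// nrD.
rewrite -rdxx rdDl !rdDr !rdxx (rdC y x); nra.
Qed.

Lemma norm_hdot_le x y : `|'[x, y]| <= `|x| * `|y|.
Proof.
set w := '[x, y]; have [->|w0] := eqVneq w 0; first by rewrite normr0 mulr_ge0.
rewrite -(@ler_pM2l _ `|w|) ?normr_gt0// -expr2 mulrA.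
have -> : `|w| * `|x| = `|w^*%C *: x| by rewrite normrZ normcJ.
rewrite sqr_normc mulrC -hdotZl !nrE -rmorphM lecE/=.
have -> : '[w^*%C *: x, y] = (complex.Re (`|w| ^+ 2))%:C.
  by rewrite hdotZl -/w mulrC -sqr_normc RRe_real// realX// normr_real.
rewrite eqxx /= -[X in X <= _]/(complex.Re (complex.Re (`|w| ^+ 2))%:C).
have := rd_le (w^*%C *: x) y; rewrite /rd hdotZl -/w mulrC -sqr_normc.
by [].
Qed.

Section Representation.
Variables (f : H -> R[i]) (M : R).
Hypotheses (fD : forall x y, f (x + y) = f x + f y)
  (fZ : forall (c : R[i]) x, f (c *: x) = c * f x)
  (fM : forall x, `|f x| <= M%:C * `|x|).

Let g x := complex.Re (f x).
Let gD x y : g (x + y) = g x + g y. Proof. by rewrite /g fD raddfD. Qed.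
Let gZ (t : R) x : g (t%:C *: x) = t * g x.
Proof. by rewrite /g fZ; case: (f x) => a b /=; rewrite mul0r subr0. Qed.
Let gM x : g x <= M * nr x.
Proof.
rewrite (le_trans (ler_norm _))// -lecR (le_trans (normc_ge_Re _))//.
by rewrite (le_trans (fM x))// nrE rmorphM.
Qed.

Let J x := rd x x - 2 * g x.
Let J_ge x : - M ^+ 2 <= J x.
Proof.
have := gM x; rewrite /J rdxx => gx.
by have := sqr_ge0 (nr x - M); nra.
Qed.
Let m := inf (range J).
Let m_le x : m <= J x.
Proof.
apply: ge_inf; last by exists x.
by exists (- M ^+ 2) => _ [y _ <-].
Qed.

Let parallelogram x y :
  nr (x - y) ^+ 2 = 2 * J x + 2 * J y - 4 * J ((2^-1)%:C *: (x + y)).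
Proof.
have -> : x - y = x + (-1)%:C *: y by rewrite rmorphN rmorph1 scaleN1r.
rewrite -rdxx /J !(rdZl, rdZr, gZ, rdDl, rdDr, gD) (rdC y x).
by field.
Qed.

Lemma riesz_representation : exists z, forall x, f x = '[x, z].
Proof.
have /choice[u uJ] : forall n : nat, exists x, J x < m + n.+1%:R^-1.
  move=> n.
  have n0 : 0 < (n.+1%:R^-1 : R) by rewrite invr_gt0.
  have [|_ [x _ <-] xm] := inf_adherent n0 (_ : has_inf (range J)).
    split; first by exists (J 0), 0.
    by exists (- M ^+ 2) => _ [y _ <-].
  by exists x.
have uE n k : nr (u n - u k) ^+ 2 <= 2 * n.+1%:R^-1 + 2 * k.+1%:R^-1.
  rewrite parallelogram; have := m_le ((2^-1)%:C *: (u n + u k)).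
  have := uJ n; have := uJ k.
  move: (J _) (J _) (J _) m n.+1%:R^-1 k.+1%:R^-1 => a b c d e e'; lra.
have inv_small (e : R) : 0 < e -> exists N, forall n, (N <= n)%N -> n.+1%:R^-1 < e.
  move=> e0; have [N _ NP] := near_infty_natSinv_lt (PosNum e0).
  by exists N => n Nn; exact: NP.
have [z uz] : exists z, forall e : R, 0 < e ->
    exists N, forall n, (N <= n)%N -> nr (u n - z) < e.
  have : cauchy (u @ \oo).
    apply/cauchyP => e e0.
    have eE : e = (complex.Re e)%:C by rewrite RRe_real// gtr0_real.
    have e'0 : 0 < complex.Re e by rewrite -ltcR -eE.
    have [N NP] := inv_small (complex.Re e ^+ 2 / 4) ltac:(by rewrite divr_gt0 ?exprn_gt0).
    exists (u N), N => // n /= Nn; rewrite -ball_normE /= nrE eE ltcR.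
    rewrite -(@ltr_pXn2r _ 2)// ?nnegrE ?nr_ge0 ?ltW//.
    have := uE N n; have := NP n Nn; have := NP N (leqnn N).
    by move: (nr _) (complex.Re e) n.+1%:R^-1 N.+1%:R^-1 => a b c d; lra.
  move=> /cauchy_cvg/cvg_ex[z /cvgrPdist_lt uz]; exists z => e e0.
  have [|N _ NP] := uz e%:C; first by rewrite ltcR.
  by exists N => n Nn; have := NP n Nn; rewrite /= distrC nrE ltcR.
have key h t : 0 <= 2 * t * (rd z h - g h) + t ^+ 2 * rd h h.
  suff keye (e : R) : 0 < e -> - e <= 2 * t * (rd z h - g h) + t ^+ 2 * rd h h.
    by apply/ler_addgt0Pl => e /keye ke; rewrite -lerBlDl sub0r.
  move=> e0.
  have [N1 N1P] := inv_small (e / 2) ltac:(by rewrite divr_gt0).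
  have c0 : 0 < 4 * `|t| * nr h + 1.
    by rewrite ltr_wpDl// !mulr_ge0// nr_ge0.
  have [N2 N2P] := uz (e / (4 * `|t| * nr h + 1)) ltac:(by rewrite divr_gt0).
  pose n := maxn N1 N2.
  have {}N1P := N1P n (leq_maxl _ _).
  have {}N2P := N2P n (leq_maxr _ _).
  have := m_le (u n + t%:C *: h).
  rewrite /J !(rdZl, rdZr, gZ, rdDl, rdDr, gD) (rdC h (u n)) => mJ.
  have uJn := uJ n; rewrite /J in uJn.
  have udiff : 2 * t * (rd (u n) h - rd z h) <= e / 2.
    have -> : rd (u n) h - rd z h = rd (u n - z) h.
      by have := rdDl (u n - z) z h; rewrite subrK => ->; rewrite addrK.
    have -> : 2 * t * rd (u n - z) h = 2 * rd (u n - z) (t%:C *: h).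
      by rewrite rdZr; ring.
    have := rd_le (u n - z) (t%:C *: h).
    have -> : nr (t%:C *: h) = `|t| * nr h.
      rewrite /nr normrZ nrE -[X in _ = X]/(complex.Re (`|t| * nr h)%:C) rmorphM.
      by congr (complex.Re (_ * _)); rewrite normc_def /= expr0n addr0 sqrtr_sqr.
    move: N2P; rewrite ltr_pdivlMr// => N2P.
    have := nr_ge0 (u n - z); nra.
  move: udiff uJn mJ N1P; rewrite -/(g (u n)).
  move: (rd _ _) (rd _ _) (rd _ _) (rd _ _) (g _) (g _) m n.+1%:R^-1.
  move=> a b c d k l m' e'; lra.
have zg h : rd z h = g h.
  apply/eqP; rewrite -subr_eq0; apply/eqP.
  set a := rd z h - g h; set b := rd h h.
  have b0 : 0 <= b by rewrite /b rdxx sqr_ge0.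
  have := key h (- a / (b + 1)); rewrite -/a -/b.
  have -> : 2 * (- a / (b + 1)) * a + (- a / (b + 1)) ^+ 2 * b =
    - (a ^+ 2 * (b + 2)) / (b + 1) ^+ 2 by field; lra.
  rewrite pmulr_lge0 ?invr_gt0 ?exprn_gt0 ?ltr_wpDl// oppr_ge0.
  rewrite pmulr_lle0 ?ltr_wpDl// => a2.
  by apply/eqP; rewrite -sqrf_eq0 eq_le a2 sqr_ge0.
exists z => x; apply/eqP; rewrite eq_complex; apply/andP; split.
  by rewrite -/(g x) -zg rdC.
have := zg ((- 'i) *: x); rewrite rdC /rd hdotZl /g fZ.
by case: '[x, z] => a b; case: (f x) => c d /=; rewrite !(oppr0, mul0r, mulN1r, sub0r, opprK) => ->.
Qed.
End Representation.

End RieszRepresentation.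

(* C*-algebras are not assumed to be unital, whence a multiplication on top of
   an lmodType rather than an lalgType. *)
HB.mixin Record isStarAlgebra (R : realType) A of GRing.Lmodule R[i] A := {
  amul : A -> A -> A;
  astar : A -> A;
  amulA : associative amul;
  amulDl : left_distributive amul +%R;
  amulDr : right_distributive amul +%R;
  amulZl : forall (c : R[i]) (a b : A), amul (c *: a) b = c *: amul a b;
  amulZr : forall (c : R[i]) (a b : A), amul a (c *: b) = c *: amul a b;
  astarK : involutive astar;
  astarD : {morph astar : a b / a + b};
  astarZ : forall (c : R[i]) (a : A), astar (c *: a) = Num.conj c *: astar a;
  astarM : forall a b : A, astar (amul a b) = amul (astar b) (astar a)
}.
#[short(type="starAlgType")]
HB.structure Definition StarAlgebra (R : realType) :=
  {A of isStarAlgebra R A & GRing.Lmodule R[i] A}.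

HB.mixin Record isCStarNormed (R : realType) A
    of StarAlgebra R A & CompleteNormedModule R[i] A := {
  ler_norm_amul : forall a b : A, `|amul a b| <= `|a| * `|b|;
  cstar_identity : forall a : A, `|amul (astar a) a| = `|a| ^+ 2
}.
#[short(type="cstarAlgType")]
HB.structure Definition CStarAlgebra (R : realType) :=
  {A of isCStarNormed R A & StarAlgebra R A & CompleteNormedModule R[i] A}.

(* Isomorphism of C*-algebras: a bijective *-homomorphism between C*-algebras is
   automatically isometric. *)
Definition star_isomorphic (R : realType) (A B : starAlgType R) :=
  exists phi : A -> B,
    [/\ bijective phi,
        forall a b, phi (a + b) = phi a + phi b,
        forall (c : R[i]) a, phi (c *: a) = c *: phi a,
        forall a b, phi (amul a b) = amul (phi a) (phi b) &
        forall a, phi (astar a) = astar (phi a)].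

Section BoundedOperators.
Context (R : realType) (H : hilbertType R).
Implicit Types (x y z : H).
Local Notation "'[ x , y ]" := (hdot x y).

Definition bounded_linear : {pred H -> H} :=
  [pred T : H -> H | `[< linear T /\
    exists M : R, forall x, `|T x| <= M%:C * `|x| >]].

Lemma bounded_linearP (T : H -> H) :
  reflect (linear T /\ exists M : R, forall x, `|T x| <= M%:C * `|x|)
    (T \in bounded_linear).
Proof. exact: asboolP. Qed.

Lemma bounded_linear_submod : submod_closed bounded_linear.
Proof.
split.
  apply/bounded_linearP; split; first by move=> c x y; rewrite scaler0 addr0.
  by exists 0 => x; rewrite normr0 rmorph0 mul0r.
move=> c S T /bounded_linearP[lS [M SM]] /bounded_linearP[lT [N TN]].
apply/bounded_linearP; split.
  move=> d x y; rewrite !fctE lS lT !scalerDr !scalerA (mulrC c).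
  by rewrite addrACA.
exists (complex.Re `|c| * M + N) => x.
have cE : `|c| = (complex.Re `|c|)%:C by rewrite RRe_real// normr_real.
have -> : (complex.Re `|c| * M + N)%:C = `|c| * M%:C + N%:C.
  by rewrite [in RHS]cE -rmorphM -rmorphD.
rewrite !fctE mulrDl.
rewrite (le_trans (ler_normD _ _))// lerD// normrZ -mulrA.
by rewrite ler_wpM2l.
Qed.

HB.instance Definition _ := GRing.isSubmodClosed.Build R[i] (H -> H)
  bounded_linear bounded_linear_submod.

Record bounded_op := BoundedOp {
  bop_fun :> H -> H;
  bop_funP : bop_fun \in bounded_linear
}.

HB.instance Definition _ := [isSub for bop_fun].
HB.instance Definition _ := [Choice of bounded_op by <:].
HB.instance Definition _ := [SubChoice_isSubLmodule of bounded_op by <:].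

Implicit Types S T : bounded_op.

Lemma bop_ext S T : S =1 T -> S = T.
Proof. by move=> ST; apply/val_inj/funext. Qed.

Lemma bopD T x y : T (x + y) = T x + T y.
Proof.
have /bounded_linearP[lT _] := bop_funP T.
by have := lT 1 x y; rewrite !scale1r.
Qed.

Lemma bopZ T (c : R[i]) x : T (c *: x) = c *: T x.
Proof.
have /bounded_linearP[lT _] := bop_funP T.
by have := lT c x 0; have := lT 1 0 0; rewrite !scale1r !addr0 => /eqP;
  rewrite eq_sym -subr_eq0 addrK => /eqP -> ->; rewrite addr0.
Qed.

Lemma comp_bounded_linear S T : S \o T \in bounded_linear.
Proof.
have /bounded_linearP[lS [M SM]] := bop_funP S.
have /bounded_linearP[lT [N TN]] := bop_funP T.
apply/bounded_linearP; split; first by move=> c x y /=; rewrite lT lS.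
exists (`|M| * N) => x /=; rewrite (le_trans (SM _))// rmorphM -mulrA.
apply: (@le_trans _ _ (`|M|%:C * `|T x|)).
  by rewrite ler_wpM2r// lecR ler_norm.
by rewrite ler_wpM2l// ler0c.
Qed.

Definition bop_comp S T := BoundedOp (comp_bounded_linear S T).

Lemma hdot_inj y z : (forall x, '[x, y] = '[x, z]) -> y = z.
Proof.
move=> yz; apply/eqP; rewrite -subr_eq0 -normr_eq0 -sqrf_eq0 -hdotxx.
by rewrite -scaleN1r hdotDr hdotZr yz -hdotZr -hdotDr scaleN1r subrr linear0r.
Qed.

Lemma adjoint_exists T :
  exists S : bounded_op, forall x y, '[T x, y] = '[x, S y].
Proof.
have /bounded_linearP[_ [M TM]] := bop_funP T.
have /choice[S TS] : forall y, exists z, forall x, '[T x, y] = '[x, z].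
  move=> y; apply: (@riesz_representation _ _ _ (M * complex.Re `|y|)).
  - by move=> x x'; rewrite bopD hdotDl.
  - by move=> c x; rewrite bopZ hdotZl.
  move=> x; rewrite (le_trans (norm_hdot_le _ _))//.
  have yE : `|y| = (complex.Re `|y|)%:C by rewrite RRe_real// normr_real.
  have -> : (M * complex.Re `|y|)%:C = M%:C * `|y|.
    by rewrite [in RHS]yE -rmorphM.
  by rewrite mulrAC ler_wpM2r.
have SP : S \in bounded_linear.
  apply/bounded_linearP; split.
    move=> c y z; apply: hdot_inj => x.
    by rewrite -TS !hdotDr !hdotZr !TS.
  exists M => y; have [->|Sy0] := eqVneq (S y) 0.
    by rewrite normr0 (le_trans _ (TM y)).
  rewrite -(@ler_pM2l _ `|S y|) ?normr_gt0// -expr2 -hdotxx -TS.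
  have := norm_hdot_le (T (S y)) y; rewrite TS hdotxx normrX normr_id => /le_trans.
  by apply; rewrite mulrA [`|S y| * _]mulrC ler_wpM2r.
by exists (BoundedOp SP) => x y /=.
Qed.

Definition adjoint T : bounded_op := projT1 (cid (adjoint_exists T)).

Lemma adjointP T x y : '[T x, y] = '[x, adjoint T y].
Proof. exact: (projT2 (cid (adjoint_exists T))). Qed.

Lemma adjoint_unique S T : (forall x y, '[T x, y] = '[x, S y]) -> adjoint T = S.
Proof.
move=> TS; apply: bop_ext => y; apply: hdot_inj => x.
by rewrite -adjointP TS.
Qed.

Lemma bop_addE S T x : (S + T) x = S x + T x. Proof. by []. Qed.
Lemma bop_scaleE (c : R[i]) T x : (c *: T) x = c *: T x. Proof. by []. Qed.

Let compA : associative bop_comp.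
Proof. by move=> S T U; apply: bop_ext. Qed.
Let compDl : left_distributive bop_comp +%R.
Proof. by move=> S T U; apply: bop_ext. Qed.
Let compDr : right_distributive bop_comp +%R.
Proof. by move=> S T U; apply: bop_ext => x; exact: bopD. Qed.
Let compZl (c : R[i]) S T : bop_comp (c *: S) T = c *: bop_comp S T.
Proof. exact: bop_ext. Qed.
Let compZr (c : R[i]) S T : bop_comp S (c *: T) = c *: bop_comp S T.
Proof. by apply: bop_ext => x; exact: bopZ. Qed.
Let adjointK : involutive adjoint.
Proof.
by move=> T; apply: adjoint_unique => x y; rewrite hdotC -adjointP -hdotC.
Qed.
Let adjointD : {morph adjoint : S T / S + T}.
Proof.
move=> S T; apply: adjoint_unique => x y.
by rewrite !bop_addE hdotDl hdotDr !adjointP.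
Qed.
Let adjointZ (c : R[i]) T : adjoint (c *: T) = Num.conj c *: adjoint T.
Proof.
apply: adjoint_unique => x y.
by rewrite !bop_scaleE hdotZl hdotZr adjointP conjcK.
Qed.
Let adjointM S T : adjoint (bop_comp S T) = bop_comp (adjoint T) (adjoint S).
Proof. by apply: adjoint_unique => x y /=; rewrite !adjointP. Qed.

HB.instance Definition _ := isStarAlgebra.Build R bounded_op
  compA compDl compDr compZl compZr adjointK adjointD adjointZ adjointM.

End BoundedOperators.

Notation "''B' ( H )" := (bounded_op H) (at level 8, format "''B' ( H )").

(* f restricts to a homeomorphism from A onto B. *)
Definition homeomorphism_on (T U : topologicalType) (A : set T) (B : set U)
    (f : T -> U) :=
  exists g : U -> T,
    [/\ set_fun A B f, set_fun B A g, {in A, cancel f g}, {in B, cancel g f} &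
        {within A, continuous f} /\ {within B, continuous g}].

Definition local_homeomorphism (T U : topologicalType) (f : T -> U) :=
  forall x, exists V : set T,
    [/\ open V, V x, open (f @` V) & homeomorphism_on V (f @` V) f].

(* A topological groupoid with unit space X. The product gmul a b is meaningful
   only when gsrc a = grng b; its other values are irrelevant. As
   grng \o gunit = id with both maps continuous, gunit identifies X with a
   subspace of the groupoid. *)
Record topGroupoid (X : topologicalType) := TopGroupoid {
  arrows :> topologicalType;
  grng : arrows -> X;
  gsrc : arrows -> X;
  gunit : X -> arrows;
  gmul : arrows -> arrows -> arrows;
  ginv : arrows -> arrows;
  grng_unit : forall u, grng (gunit u) = u;
  gsrc_unit : forall u, gsrc (gunit u) = u;
  grngM : forall a b, gsrc a = grng b -> grng (gmul a b) = grng a;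
  gsrcM : forall a b, gsrc a = grng b -> gsrc (gmul a b) = gsrc b;
  gmulA : forall a b c, gsrc a = grng b -> gsrc b = grng c ->
    gmul a (gmul b c) = gmul (gmul a b) c;
  gmul1l : forall a, gmul (gunit (grng a)) a = a;
  gmul1r : forall a, gmul a (gunit (gsrc a)) = a;
  grngV : forall a, grng (ginv a) = gsrc a;
  gsrcV : forall a, gsrc (ginv a) = grng a;
  gmulV : forall a, gmul a (ginv a) = gunit (grng a);
  gmulVl : forall a, gmul (ginv a) a = gunit (gsrc a);
  grng_continuous : continuous grng;
  gsrc_continuous : continuous gsrc;
  gunit_continuous : continuous gunit;
  gmul_continuous : {within [set p : arrows * arrows | gsrc p.1 = grng p.2],
    continuous (fun p => gmul p.1 p.2)};
  ginv_continuous : continuous ginv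
}.

Definition etale (X : topologicalType) (G : topGroupoid X) :=
  local_homeomorphism (@grng X G) /\ local_homeomorphism (@gsrc X G).

Definition circle (R : realType) : set R[i] := [set z | `|z| = 1].

(* The unit spaces of the twist and of G are identified: both are X. *)
Record twist (R : realType) (X : topologicalType) (G : topGroupoid X) := Twist {
  tgrp :> topGroupoid X;
  tiota : X -> R[i] -> tgrp;
  tq : tgrp -> G;
  twist_locally_compact : locally_compact [set: tgrp];
  twist_hausdorff : hausdorff_space tgrp;
  tiota_rng : forall u z, circle z -> grng (tiota u z) = u;
  tiota_src : forall u z, circle z -> gsrc (tiota u z) = u;
  tiota1 : forall u, tiota u 1 = gunit tgrp u;
  tiotaM : forall u z w, circle z -> circle w ->
    tiota u (z * w) = gmul (tiota u z) (tiota u w);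
  tiota_homeo :
    homeomorphism_on ([set: X] `*` @circle R) (tq @^-1` range (gunit G))
      (fun p => tiota p.1 p.2);
  tq_rng : forall a, grng (tq a) = grng a;
  tq_src : forall a, gsrc (tq a) = gsrc a;
  tq_unit : forall u, tq (gunit tgrp u) = gunit G u;
  tqM : forall a b, gsrc a = grng b -> tq (gmul a b) = gmul (tq a) (tq b);
  tq_continuous : continuous tq;
  tq_open : forall U : set tgrp, open U -> open (tq @` U);
  tq_surj : forall x, exists a, tq a = x;
  twist_central : forall a z, circle z ->
    gmul (tiota (grng a) z) a = gmul a (tiota (gsrc a) z);
  twist_locally_trivial : forall x : G, exists (U : set G) (psi : G * R[i] -> tgrp),
    [/\ open U, U x,
        homeomorphism_on (U `*` @circle R) (tq @^-1` U) psi,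
        forall y z, U y -> circle z -> tq (psi (y, z)) = y &
        forall y z w, U y -> circle z -> circle w ->
          psi (y, z * w) = gmul (tiota (grng y) z) (psi (y, w))]
}.

Section ReducedNorm.
Context (R : realType) (X : topologicalType) (G : topGroupoid X).
Variable S : twist R G.
Implicit Types (f g h : S -> R[i]) (u : X).

Definition tact (z : R[i]) (a : S) : S := gmul (tiota S (grng a) z) a.

Definition equivariant f := forall z a, circle z -> f (tact z a) = z * f a.

Definition Cc : set (S -> R[i]) :=
  [set f | [/\ continuous f, equivariant f &
               compact (closure [set a | f a != 0])]].

(* A choice of one representative in S for each element of G. *)
Definition trep (x : G) : S := projT1 (cid (tq_surj S x)).

Lemma trepK x : tq (trep x) = x.
Proof. exact: (projT2 (cid (tq_surj S x))). Qed.

(* The sum over G^(r(a)). For f in Cc only finitely many summands are nonzero,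
   so the finitely supported sum is the sum of the formula. *)
Definition conv f g : S -> R[i] := fun a =>
  \sum_(x \in [set x : G | grng x = grng a])
    f (trep x) * g (gmul (ginv (trep x)) a).

Definition finvol f : S -> R[i] := fun a => Num.conj (f (ginv a)).

Definition l2norm u h : \bar R :=
  sqrte (\esum_(x in [set x : G | gsrc x = u])
           ((complex.Re `|h (trep x)|) ^+ 2)%:E).

(* A function on q^-1(G_u) is represented by its extension by 0 to S. *)
Definition l2 u : set (S -> R[i]) :=
  [set h | [/\ equivariant h, forall a, gsrc a <> u -> h a = 0 &
               (l2norm u h < +oo)%E]].

Definition regular_rep f : (S -> R[i]) -> (S -> R[i]) := conv f.

Definition regular_rep_norm u f : \bar R :=
  ereal_sup [set l2norm u (regular_rep f h) | h in
              [set h | l2 u h /\ (l2norm u h <= 1)%E]].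

(* The element 0 makes the supremum 0 when X is empty; it changes nothing
   otherwise. *)
Definition reduced_norm f : \bar R :=
  ereal_sup (0%E |` range (regular_rep_norm ^~ f)).

(* A is the completion of the *-algebra Cc for the reduced norm: it contains an
   isometric image of Cc, by a *-homomorphism, as a dense *-subalgebra. Such a
   C*-algebra is unique up to *-isomorphism. *)
Definition is_reduced_cstar_algebra (A : cstarAlgType R) :=
  exists j : (S -> R[i]) -> A,
    [/\ (forall f g, Cc f -> Cc g -> j (f + g) = j f + j g) /\
        (forall (c : R[i]) f, Cc f -> j (c *: f) = c *: j f),
        forall f g, Cc f -> Cc g -> j (conv f g) = amul (j f) (j g),
        forall f, Cc f -> j (finvol f) = astar (j f),
        forall f, Cc f -> (complex.Re `|j f|)%:E = reduced_norm f &
        dense (j @` Cc)].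

End ReducedNorm.

(* Main.v *)
Require Import Defs.
From HB Require Import structures.
From mathcomp Require Import all_boot all_order all_algebra.
From mathcomp Require Import sesquilinear complex finmap.
From mathcomp Require Import all_classical all_reals all_analysis.
From mathcomp Require Import ring lra.
Import Order.TTheory GRing.Theory Num.Theory.
Import numFieldNormedType.Exports.
Local Open Scope classical_set_scope.
Local Open Scope complex_scope.
Local Open Scope ring_scope.

(** If X is finite, then the étale Hausdorff groupoid G is discrete, and
    [gtrace f], the sum over the units u of Re f(u), is the restriction to
    C_c(G,S) of a bounded trace on A, with gtrace(f^* f) the squared l2-norm of f.
    This trace is faithful: by Cauchy-Schwarz, an element of A that is a limit
    of functions of arbitrarily small l2-norm acts as 0 in every regular
    representation. In B(H), on the other hand, there are for every n
    equivalent rank one projections p_1, ..., p_n whose sum is a projection: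
    they have the same trace t > 0, and n t is at most the norm of the trace.
    The trace is never extended to A: the rank one operators are approximated
    by images of elements of C_c(G,S) instead. *)

Set Implicit Arguments.
Unset Strict Implicit.
Unset Printing Implicit Defensive.

(* MathComp-Analysis has a [conv] too, in convex.v. *)
Local Notation conv := Defs.conv.

(** * Norms with values in R *)

(** Norms over [R[i]] are real elements of [R[i]]; their real parts live in the ordered field [R],
    where [lra] and [nra] apply. *)
Definition rnorm (R : realType) (V : normedZmodType R[i]) (x : V) : R :=
  complex.Re `|x|.

Section RealNorm.
Context (R : realType).
Implicit Types (V : normedZmodType R[i]) (z w : R[i]).

Lemma rnormE V (x : V) : `|x| = (rnorm x)%:C.
Proof. by rewrite RRe_real// normr_real. Qed.

Lemma rnorm_ge0 V (x : V) : 0 <= rnorm x.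
Proof. by rewrite -ler0c -rnormE. Qed.

Lemma rnorm0 V : rnorm (0 : V) = 0.
Proof. by rewrite /rnorm normr0. Qed.

Lemma rnorm0_eq0 V (x : V) : rnorm x = 0 -> x = 0.
Proof. by move=> x0; apply/normr0_eq0; rewrite rnormE x0. Qed.

Lemma rnormD V (x y : V) : rnorm (x + y) <= rnorm x + rnorm y.
Proof. by rewrite -lecR rmorphD/= -!rnormE ler_normD. Qed.

Lemma rnormB V (x y : V) : rnorm (x - y) = rnorm (y - x).
Proof. by rewrite /rnorm distrC. Qed.

Lemma rnorm_sum V I (s : seq I) (P : pred I) (F : I -> V) :
  rnorm (\sum_(i <- s | P i) F i) <= \sum_(i <- s | P i) rnorm (F i).
Proof.
elim/big_ind2 : _ => //; first by rewrite rnorm0.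
by move=> x a y b xa yb; rewrite (le_trans (rnormD _ _))// lerD.
Qed.

Lemma rnormM z w : rnorm (z * w) = rnorm z * rnorm w.
Proof.
have := normrM z w; rewrite !rnormE -rmorphM => /(congr1 (@complex.Re R)).
by [].
Qed.

Lemma rnorm_conj z : rnorm (Num.conj z) = rnorm z.
Proof. by rewrite /rnorm norm_conjC. Qed.

Lemma mul_conj_rnorm z : z * Num.conj z = (rnorm z ^+ 2)%:C.
Proof. by rewrite -normCK rnormE rmorphXn. Qed.

Lemma circleP z : circle z <-> rnorm z = 1.
Proof.
by rewrite /circle/= rnormE; split=> [/(congr1 (@complex.Re R))|->].
Qed.

Lemma circleM z w : circle z -> circle w -> circle (z * w).
Proof. by move=> /circleP z1 /circleP w1; apply/circleP; rewrite rnormM z1 w1 mulr1. Qed.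

Lemma circle1 : circle (1 : R[i]).
Proof. by rewrite /circle/= normr1. Qed.

Lemma circle_conj z : circle z -> circle (Num.conj z).
Proof. by rewrite !circleP rnorm_conj. Qed.

Lemma circle_mul_conj z : circle z -> z * Num.conj z = 1.
Proof. by move=> /circleP z1; rewrite mul_conj_rnorm z1 expr1n. Qed.

Lemma Re_le_rnorm z : `|complex.Re z| <= rnorm z.
Proof. by rewrite -lecR -rnormE normc_ge_Re. Qed.

(** The circle is closed and lies in the image of a square under the continuous map
    [(a, b) |-> a + ib]. *)
Lemma compact_circle : compact (@circle R).
Proof.
pose f (p : R * R) : R[i] := p.1 +i* p.2.
have fE p : f p = p.1%:C + p.2%:C * 'i by rewrite [LHS]complexE mulrC.
have cC : continuous (fun t : R => t%:C : R[i]).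
  move=> t; apply/cvgrPdist_lt => e e0.
  have eE : e = (complex.Re e)%:C by rewrite RRe_real// gtr0_real.
  have e'0 : 0 < complex.Re e by rewrite -ltcR -eE.
  near=> s; rewrite -rmorphB/= normc_def /= expr0n addr0 sqrtr_sqr eE ltcR.
  by near: s; apply: cvgr_dist_lt.
have cf : continuous f.
  rewrite (_ : f = fun p => p.1%:C + p.2%:C * 'i); last exact/funext.
  move=> p; apply: cvgD.
    by apply: (continuous_comp _ (cC _)); exact: cvg_fst.
  apply: cvgM; last exact: cvg_cst.
  by apply: (continuous_comp _ (cC _)); exact: cvg_snd.
have K : compact (f @` (`[-1, 1] `*` `[-1, 1])).
  apply: continuous_compact; first exact: continuous_subspaceT.
  by apply: compact_setX; exact: segment_compact.
apply: (subclosed_compact _ K).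
  rewrite (_ : circle (R:=R) = (fun z : R[i] => `|z|) @^-1` [set 1])//.
  apply: preimage_closed.
    by move=> z _; exact: (@norm_continuous R[i] R[i]^o z).
  exact/accessible_closed_set1/hausdorff_accessible/norm_hausdorff.
move=> [a b] /circleP; rewrite /rnorm normc_def/= => ab1.
have {}ab1 : a ^+ 2 + b ^+ 2 = 1.
  have := sqr_sqrtr (addr_ge0 (sqr_ge0 a) (sqr_ge0 b)).
  by rewrite ab1 expr1n => <-.
exists (a, b) => //=; split => /=; rewrite in_itv/=; nra.
Unshelve. all: by end_near. Qed.

End RealNorm.

(** * Algebra of twists *)

Section Groupoid.
Context (X : topologicalType) (G : topGroupoid X).
Implicit Types a b c : G.

Lemma gmulKl a b : gsrc a = grng b -> gmul (ginv a) (gmul a b) = b.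
Proof.
by move=> ab; rewrite gmulA ?gsrcV// gmulVl ab gmul1l.
Qed.

Lemma gmulKVl a b : grng a = grng b -> gmul a (gmul (ginv a) b) = b.
Proof.
by move=> ab; rewrite gmulA ?gsrcV ?grngV// gmulV ab gmul1l.
Qed.

Lemma ginv_unique a b : gsrc a = grng b -> gmul a b = gunit G (grng a) ->
  b = ginv a.
Proof.
by move=> ab abE; rewrite -(gmulKl ab) abE -(gsrcV a) gmul1r.
Qed.

Lemma ginvK : involutive (@ginv X G).
Proof.
by move=> a; rewrite -(@ginv_unique (ginv a) a) ?gsrcV// gmulVl grngV.
Qed.

Lemma ginvM a b : gsrc a = grng b -> ginv (gmul a b) = gmul (ginv b) (ginv a).
Proof.
move=> ab; rewrite -(@ginv_unique (gmul a b) (gmul (ginv b) (ginv a)))//.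
  by rewrite gsrcM// grngM ?grngV// gsrcV.
rewrite -gmulA ?grngM ?gsrcV ?grngV//.
by rewrite gmulKVl ?grngV// gmulV.
Qed.

Lemma ginv_unit u : ginv (gunit G u) = gunit G u.
Proof.
apply/esym/ginv_unique; first by rewrite gsrc_unit grng_unit.
by have := gmul1l (gunit G u); rewrite !grng_unit.
Qed.

End Groupoid.

(** * The circle action on a twist, equivariant functions and their supports *)

Section Twist.
Context (R : realType) (X : topologicalType) (G : topGroupoid X).
Variable S : twist R G.
Implicit Types (a b : S) (z w : R[i]) (f g h : S -> R[i]) (x y : G).

Lemma tq_inv a : tq (ginv a) = ginv (tq a).
Proof.
apply: ginv_unique; first by rewrite tq_src tq_rng grngV.
by rewrite -tqM ?grngV// gmulV tq_unit tq_rng.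
Qed.

Lemma tq_iota u z : circle z -> tq (tiota S u z) = gunit G u.
Proof.
move=> z1; have [k [/(_ (u, z)) mem _ _ _ _]] := tiota_homeo S.
have /= [|v _ vE] := mem; first by split.
(* So far [iota(u, z)] lies over some unit [v]; comparing ranges gives [v = u]. *)
have := congr1 (@grng X G) vE.
by rewrite grng_unit tq_rng tiota_rng// => vu; rewrite -vE vu.
Qed.

Lemma grng_tact z a : circle z -> grng (tact z a) = grng a.
Proof. by move=> z1; rewrite grngM ?tiota_rng ?tiota_src. Qed.

Lemma gsrc_tact z a : circle z -> gsrc (tact z a) = gsrc a.
Proof. by move=> z1; rewrite gsrcM// tiota_src. Qed.

Lemma tq_tact z a : circle z -> tq (tact z a) = tq a.
Proof.
by move=> z1; rewrite tqM ?tiota_src// tq_iota// -(tq_rng a) gmul1l.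
Qed.

Lemma tact1 a : tact 1 a = a.
Proof. by rewrite /tact tiota1 gmul1l. Qed.

Lemma tactM z w a : circle z -> circle w ->
  tact z (tact w a) = tact (z * w) a.
Proof.
move=> z1 w1; rewrite {1}/tact grng_tact// /tact.
by rewrite gmulA ?tiota_src ?tiota_rng// tiotaM.
Qed.

Lemma gmul_tactl z a b : circle z -> gsrc a = grng b ->
  gmul (tact z a) b = tact z (gmul a b).
Proof.
by move=> z1 ab; rewrite /tact grngM// -gmulA ?tiota_src.
Qed.

(** Centrality carries [z] across [a]. *)
Lemma gmul_tactr z a b : circle z -> gsrc a = grng b ->
  gmul a (tact z b) = tact z (gmul a b).
Proof.
move=> z1 ab; rewrite -gmul_tactl// /tact.
by rewrite -ab gmulA ?tiota_src ?tiota_rng// -twist_central.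
Qed.

Lemma ginv_tact z a : circle z -> ginv (tact z a) = tact (Num.conj z) (ginv a).
Proof.
move=> z1; have cz1 := circle_conj z1.
rewrite -(@ginv_unique _ _ (tact z a) (tact (Num.conj z) (ginv a)))//.
  by rewrite gsrc_tact// grng_tact// grngV.
rewrite gmul_tactl ?grng_tact ?grngV// gmul_tactr ?grngV//.
by rewrite tactM// circle_mul_conj// tact1 gmulV.
Qed.

(** The element [b a^-1] lies over a unit, hence is some [iota(u, z)]; multiplying it by [a] gives
    back [b]. *)
Lemma tq_eq a b : tq a = tq b -> exists2 z, circle z & b = tact z a.
Proof.
move=> ab.
have rab : grng a = grng b by rewrite -!tq_rng ab.
have sab : gsrc a = gsrc b by rewrite -!tq_src ab.
have [k [_ mem _ kK _]] := tiota_homeo S.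
have bV : (tq (t:=S) @^-1` range (gunit G)) (gmul b (ginv a)).
  exists (grng b) => //.
  by rewrite tqM ?grngV// tq_inv ab gmulV tq_rng.
have [_ z1] := mem _ bV; exists (k (gmul b (ginv a))).2 => //.
have := kK _ (mem_set bV); case: (k _) z1 => u z /= z1 uE.
have uE' : u = grng a.
  by rewrite -(tiota_rng S u z1) uE grngM ?grngV.
by rewrite /tact -uE' uE -gmulA ?grngV ?gsrcV// gmulVl sab gmul1r.
Qed.

Lemma rnorm_equivariant f a b : equivariant f -> tq a = tq b ->
  rnorm (f a) = rnorm (f b).
Proof.
by move=> ef /tq_eq[z z1 ->]; rewrite ef// rnormM; move/circleP : z1 => ->; rewrite mul1r.
Qed.

Lemma rnorm_trep f a : equivariant f -> rnorm (f (trep S (tq a))) = rnorm (f a).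
Proof. by move=> ef; apply: rnorm_equivariant => //; rewrite trepK. Qed.

Lemma grng_trep x : grng (trep S x) = grng x.
Proof. by rewrite -tq_rng trepK. Qed.

Lemma gsrc_trep x : gsrc (trep S x) = gsrc x.
Proof. by rewrite -tq_src trepK. Qed.

(** Supports are taken in [G], where they can be finite; for equivariant [f] the choice of
    representatives does not affect them. *)
Definition gsupp f : set G := [set x | f (trep S x) != 0].

Lemma gsuppP f a : equivariant f -> gsupp f (tq a) <-> f a != 0.
Proof.
move=> ef; have := rnorm_trep a ef; rewrite /gsupp/= => E.
split; apply: contra_neq => fa0; apply: rnorm0_eq0.
  by rewrite E fa0 rnorm0.
by rewrite -E fa0 rnorm0.
Qed.

Lemma conv_equivariant f g : equivariant g -> equivariant (conv f g).
Proof.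
move=> eg z a z1; rewrite /conv grng_tact// mulr_fsumr.
apply: eq_fsbigr => x; rewrite inE/= => xa.
by rewrite gmul_tactr// ?gsrcV ?grng_trep// eg// mulrCA.
Qed.

Lemma finvol_equivariant f : equivariant f -> equivariant (finvol f).
Proof.
move=> ef z a z1.
rewrite /finvol ginv_tact// ef; last exact: circle_conj.
by rewrite rmorphM/= conjCK.
Qed.

Lemma equivariantD f g : equivariant f -> equivariant g -> equivariant (f + g).
Proof. by move=> ef eg z a z1; rewrite !fctE ef// eg// mulrDr. Qed.

Lemma equivariantZ c f : equivariant f -> equivariant (c *: f).
Proof. by move=> ef z a z1; rewrite !fctE ef// mulrCA. Qed.

Lemma gsuppD f g : gsupp (f + g) `<=` gsupp f `|` gsupp g.
Proof.
move=> x; rewrite /gsupp/= fctE => /eqP fg0.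
have [fx|] := eqVneq (f (trep S x)) 0; last by left.
by right; apply/eqP => gx; apply: fg0; rewrite fx gx addr0.
Qed.

Lemma gsuppZ c f : gsupp (c *: f) `<=` gsupp f.
Proof. by move=> x; rewrite /gsupp/= fctE; apply: contra_neq => ->; rewrite scaler0. Qed.

(** Since [y = x (x^-1 y)], every term of the sum at a [y] outside the product set has a zero
    factor. *)
Lemma gsupp_conv f g : equivariant g ->
  gsupp (conv f g) `<=` [set gmul x y | x in gsupp f & y in gsupp g].
Proof.
move=> eg y; apply: contraPP => /= yN; rewrite /gsupp/=; apply/negP.
rewrite negbK; apply/eqP; apply: fsbig1 => x/=; rewrite grng_trep => xy.
apply/eqP; rewrite mulf_eq0 -implyNb; apply/implyP => fx.
apply: contrapT => /negP gx; apply: yN.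
exists x => //; exists (gmul (ginv x) y).
  rewrite -[gmul (ginv x) y](_ : tq (gmul (ginv (trep S x)) (trep S y)) = _).
    exact/(gsuppP _ eg).
  by rewrite tqM ?gsrcV ?grng_trep// ?tq_inv ?trepK//.
by rewrite gmulKVl.
Qed.

Lemma gsupp_finvol f : equivariant f -> gsupp (finvol f) = @ginv X G @^-1` gsupp f.
Proof.
move=> ef; apply/seteqP; split => x; rewrite /preimage/= /gsupp/=.
  rewrite /finvol conjC_eq0 => /(gsuppP _ ef).
  by rewrite tq_inv trepK.
move=> fx; rewrite /finvol conjC_eq0; apply/(gsuppP _ ef).
by rewrite tq_inv trepK.
Qed.

(** [D] may exceed the support, so that several functions can be summed over one finite set. *)
Lemma conv_sum (D : {fset G}) f g a : gsupp f `<=` [set` D] ->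
  conv f g a = \sum_(x <- D | `[< grng x = grng a >])
    f (trep S x) * g (gmul (ginv (trep S x)) a).
Proof.
move=> fD; rewrite /conv fsbig_mkcond.
rewrite -(fsbig_widen [set` D] setT)//=; last first.
  move=> x [_ /=] xD; rewrite patchE; case: ifPn => // _.
  have [->|fx] := eqVneq (f (trep S x)) 0; first by rewrite mul0r.
  by case: xD; exact: fD.
rewrite fsbig_finite//= set_fsetK big_mkcond/= [RHS]big_mkcond/=.
by apply: eq_bigr => x _; rewrite patchE; case: asboolP => xa; [rewrite mem_set|rewrite memNset].
Qed.

End Twist.

(** * Discrete groupoids *)

Lemma finite_hausdorff_discrete (X : topologicalType) :
  hausdorff_space X -> finite_set [set: X] -> forall A : set X, open A.
Proof.
move=> /hausdorff_accessible/accessible_finite_set_closed cX fX A.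
by rewrite -[A]setCK openC; apply: cX; exact: sub_finite_set fX.
Qed.

(** If [K] were infinite, the sets [U] with finite [K \ U] would form a proper filter containing
    [K]. At a cluster point [x], the neighbourhood [{x}] would meet the complement of [{x}]. *)
Lemma compact_discrete_finite (X : topologicalType) (K : set X) :
  (forall x : X, open [set x]) -> compact K -> finite_set K.
Proof.
move=> dX cK; apply: contrapT => Kinf.
pose F : set_system X := [set U | finite_set (K `\` U)].
have FF : ProperFilter F.
  split=> /=; first by rewrite /F/= setD0.
  split; rewrite /F/=.
  - by rewrite setDT.
  - by move=> P Q /= KP KQ; rewrite setDIr finite_setU.
  - by move=> P Q PQ /=; apply: sub_finite_set; exact: setDS.
have [|x [Kx]] := cK F FF; first by rewrite /F/= setDv.
move=> /(_ (~` [set x]) [set x]) [].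
- rewrite /F/=; apply: (@sub_finite_set _ _ [set x]); last exact: finite_set1.
  by move=> y [_ /contrapT].
- by apply: open_nbhs_nbhs; split.
by move=> y [/= + yx]; apply.
Qed.

(** The unit map is continuous and, having [grng] as left inverse, injective; so disjoint
    neighbourhoods pull back. *)
Lemma hausdorff_units (X : topologicalType) (G : topGroupoid X) :
  hausdorff_space G -> hausdorff_space X.
Proof.
rewrite !open_hausdorff => hG u v uv.
have /hG[[A B] /= [uA vB] [oA oB AB]] : gunit G u != gunit G v.
  by apply: contra_neq uv => /(congr1 (@grng X G)); rewrite !grng_unit.
exists (gunit G @^-1` A, gunit G @^-1` B) => /=.
  by rewrite !inE in uA vB *.
split.
- by apply: open_comp => // x _; exact: gunit_continuous.
- by apply: open_comp => // x _; exact: gunit_continuous.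
- by rewrite -preimage_setI (eqP AB) preimage_set0.
Qed.

(** On a neighbourhood [V] of [x] where the range map is injective, [{x}] is cut out by the open
    condition of having the range of [x]. *)
Lemma etale_discrete (X : topologicalType) (G : topGroupoid X) :
  (forall A : set X, open A) -> etale G -> forall x : G, open [set x].
Proof.
move=> dX [rG _] x; have [V [oV Vx _ [k [_ _ rK _ _]]]] := rG x.
rewrite (_ : [set x] = V `&` @grng X G @^-1` [set grng x]).
  apply: openI => //; apply: open_comp => // y _; exact: grng_continuous.
apply/seteqP; split => [_ ->//|y [Vy /= yx]].
by rewrite -(rK y) ?inE// yx rK ?inE.
Qed.

(** * Over a discrete groupoid, [Cc] consists of the finitely supported equivariant functions *)

Section DiscreteTwist.
Context (R : realType) (X : topologicalType) (G : topGroupoid X).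
Variable S : twist R G.
Hypothesis dG : forall x : G, open [set x].
Implicit Types (f g : S -> R[i]) (x : G).

Let fiber x : set S := tq (t:=S) @^-1` [set x].

Let open_fiber x : open (fiber x).
Proof. by apply: open_comp => // a _; exact: tq_continuous. Qed.

(** A local trivialisation presents the fibre as the continuous image of [{x}] times the circle. *)
Lemma compact_fiber x : compact (fiber x).
Proof.
have [U [psi [_ Ux [k [_ mem _ kK [psic _]]] psiE _]]] := twist_locally_trivial S x.
rewrite (_ : fiber x = psi @` ([set x] `*` @circle R)).
  apply: continuous_compact; last first.
    by apply: compact_setX; [exact: compact_set1|exact: compact_circle].
  by apply: continuous_subspaceW psic => -[y z] /= [-> ?]; split.
apply/seteqP; split => [a /= ax|_ [[y z] /= [-> z1] <-]]; last exact: psiE.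
have aU : (tq (t:=S) @^-1` U) a by rewrite /preimage/= ax.
have [/= Uk k1] := mem _ aU; exists (k a); last by rewrite kK ?inE.
split => //=; rewrite -ax -[in RHS](kK a) ?inE//.
by case: (k a) Uk k1 => y z Uy z1 /=; rewrite psiE.
Qed.

(** The fibre through [a] is open, and on it [f] is a constant times the circle coordinate of a
    local trivialisation, which is continuous. *)
Lemma equivariant_continuous f : equivariant f -> continuous f.
Proof.
move=> ef a; pose x := tq a.
have [U [psi [oU Ux [k [_ mem _ kK [_ kc]]] psiE psiM]]] := twist_locally_trivial S x.
have oV : open (tq (t:=S) @^-1` U).
  by apply: open_comp => // b _; exact: tq_continuous.
have {kc} kc : continuous_at a k.
  by move: kc; rewrite continuous_open_subspace//; apply; rewrite inE.
have fE b : tq b = x -> f b = (k b).2 * f (psi (x, 1)).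
  move=> bx; have Vb : (tq (t:=S) @^-1` U) b by rewrite /preimage/= bx.
  have [Uk k1] := mem _ Vb; have := kK _ (mem_set Vb).
  case: (k b) Uk k1 => y z /= Uy z1 kb.
  have yx : y = x by rewrite -bx -kb psiE.
  rewrite -kb yx -{1}(mulr1 z) psiM//; last exact: circle1.
  rewrite -ef// /tact; congr (f (gmul (tiota S _ z) _)).
  by rewrite -tq_rng psiE//; exact: circle1.
rewrite /continuous_at fE//.
have : (fun b => (k b).2 * f (psi (x, 1))) b @[b --> a] --> (k a).2 * f (psi (x, 1)).
  apply: cvgM; last exact: cvg_cst.
  by apply: (continuous_comp (f := k) (g := snd)) => //; exact: cvg_snd.
apply: cvg_trans; apply: near_eq_cvg.
have : nbhs a (fiber x) by apply: open_nbhs_nbhs; split.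
by apply: filterS => b /fE ->.
Qed.

(** The image in [G] of a compact support is compact, hence finite. Conversely, a finite union of
    fibres is compact and closed, so it contains the closed support. *)
Lemma Cc_finite f : Cc f <-> equivariant f /\ finite_set (gsupp f).
Proof.
split=> [[_ ef cf]|[ef finf]].
  split=> //; apply: (@sub_finite_set _ _ (tq (t:=S) @` closure [set a | f a != 0])).
    by move=> x fx; exists (trep S x); [exact: subset_closure|exact: trepK].
  apply: compact_discrete_finite => //; apply: continuous_compact => //.
  by apply: continuous_subspaceT => a; exact: tq_continuous.
split => //; first exact: equivariant_continuous.
have K : compact (\bigcup_(x in gsupp f) fiber x).
  rewrite -bigsetU_fset_set//; apply: bigsetU_compact => x _; exact: compact_fiber.
apply: (subclosed_compact _ K); first exact: closed_closure.
have /closure_id -> : closed (\bigcup_(x in gsupp f) fiber x).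
  by apply: compact_closed => //; exact: twist_hausdorff.
apply: closure_subset => a /= fa; exists (tq a) => //.
exact/(gsuppP _ ef).
Qed.

Lemma CcD f g : Cc f -> Cc g -> Cc (f + g).
Proof.
rewrite !Cc_finite => -[ef ff] [eg fg]; split; first exact: equivariantD.
by apply: sub_finite_set (@gsuppD _ _ _ _ f g) _; rewrite finite_setU.
Qed.

Lemma CcZ c f : Cc f -> Cc (c *: f).
Proof.
rewrite !Cc_finite => -[ef ff]; split; first exact: equivariantZ.
exact: sub_finite_set (@gsuppZ _ _ _ _ c f) _.
Qed.

Lemma Cc_conv f g : Cc f -> Cc g -> Cc (conv f g).
Proof.
rewrite !Cc_finite => -[ef ff] [eg fg]; split; first exact: conv_equivariant.
by apply: sub_finite_set (@gsupp_conv _ _ _ _ f g eg) _; exact: finite_image2.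
Qed.

Lemma Cc_finvol f : Cc f -> Cc (finvol f).
Proof.
rewrite !Cc_finite => -[ef ff]; split; first exact: finvol_equivariant.
rewrite gsupp_finvol//; apply: (@sub_finite_set _ _ (@ginv X G @` gsupp f)).
  by move=> x /= fx; exists (ginv x); rewrite ?ginvK.
exact: finite_image.
Qed.

End DiscreteTwist.

(** * The reduced norm and the trace *)

Section NormEstimates.
Context (R : realType) (X : topologicalType) (G : topGroupoid X).
Variable S : twist R G.
Implicit Types (f g h : S -> R[i]) (x : G) (u : X).

(** With its converse [sum_le_l2norm], this turns estimates of the extended real norm into estimates
    of finite real sums. *)
Lemma l2norm_le u h (c : R) : 0 <= c ->
  (forall B : {fset G}, (forall x, x \in B -> gsrc x = u) ->
    \sum_(x <- B) rnorm (h (trep S x)) ^+ 2 <= c ^+ 2) ->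
  (l2norm u h <= c%:E)%E.
Proof.
move=> c0 hB; rewrite -[c]ger0_norm// -sqrtr_sqr.
rewrite -[(Num.sqrt _)%:E]/(sqrte (c ^+ 2)%:E).
rewrite lee_sqrt ?lee_fin ?sqr_ge0//.
apply: ge_ereal_sup => _ [B [fB Bu] <-].
rewrite fsbig_finite// sumEFin lee_fin; apply: hB => x.
by rewrite in_fset_set// inE => /Bu.
Qed.

Lemma sum_le_l2norm u h (c : R) (B : {fset G}) : 0 <= c ->
  (l2norm u h <= c%:E)%E -> (forall x, x \in B -> gsrc x = u) ->
  \sum_(x <- B) rnorm (h (trep S x)) ^+ 2 <= c ^+ 2.
Proof.
move=> c0; rewrite -[c in c%:E]ger0_norm// -sqrtr_sqr.
rewrite -[(Num.sqrt _)%:E]/(sqrte (c ^+ 2)%:E).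
rewrite lee_sqrt ?lee_fin ?sqr_ge0// => hc Bu.
rewrite -lee_fin (le_trans _ hc)//; apply: esum_ge.
exists [set` B]; first by split => // x /= /Bu.
by rewrite fsbig_finite//= set_fsetK sumEFin.
Qed.

Lemma l2norm_conv_le u f h (c : \bar R) : (reduced_norm f <= c)%E ->
  l2 u h -> (l2norm u h <= 1)%E -> (l2norm u (conv f h) <= c)%E.
Proof.
move=> fc hu h1; apply: le_trans fc.
apply: (@le_trans _ _ (regular_rep_norm u f)).
  by apply: ereal_sup_ubound; exists h.
by apply: ereal_sup_ubound; right; exists u.
Qed.

Lemma tiota_inj u z w : circle z -> circle w -> tiota S u z = tiota S u w ->
  z = w.
Proof.
move=> z1 w1 zw; have [k [_ _ Kk _ _]] := tiota_homeo S.
have /= := Kk (u, z); rewrite inE/= => /(_ (conj I z1)).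
by rewrite zw; have /= := Kk (u, w); rewrite inE/= => /(_ (conj I w1)) -> [].
Qed.

Lemma tq_gunit u a : tq a = gunit G u -> exists2 z, circle z & a = tiota S u z.
Proof.
rewrite -(tq_unit S) => /esym/tq_eq[z z1 ->]; exists z => //.
by rewrite /tact grng_unit -{2}(tiota_src S u z1) gmul1r.
Qed.

(** The unit vector at [u]: it takes the value 1 at the unit itself, and equivariance then forces
    [z] at [iota(u, z)]. Over [u] the default of [xget] never occurs, by [tq_gunit]. *)
Definition unit_delta u : S -> R[i] := fun a =>
  if `[< tq a = gunit G u >] then xget 0 [set z | circle z /\ a = tiota S u z]
  else 0.

Lemma unit_deltaE u z : circle z -> unit_delta u (tiota S u z) = z.
Proof.
move=> z1; rewrite /unit_delta asboolT ?tq_iota//.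
by case: xgetP => [w _ [w1 /tiota_inj->//]|/(_ z)[]].
Qed.

Lemma unit_delta_eq0 u a : tq a <> gunit G u -> unit_delta u a = 0.
Proof. by move=> au; rewrite /unit_delta asboolF. Qed.

Lemma rnorm_unit_delta u a : tq a = gunit G u -> rnorm (unit_delta u a) = 1.
Proof. by move=> /tq_gunit[z z1 ->]; rewrite unit_deltaE//; exact/circleP. Qed.

Lemma unit_delta_equivariant u : equivariant (unit_delta u).
Proof.
move=> z a z1; have [au|au] := pselect (tq a = gunit G u); last first.
  by rewrite !unit_delta_eq0 ?mulr0// tq_tact.
have [w w1 ->] := tq_gunit au; rewrite /tact tiota_rng// -tiotaM//.
by rewrite !unit_deltaE//; exact: circleM.
Qed.

Lemma l2norm_unit_delta u : (l2norm u (unit_delta u) <= 1)%E.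
Proof.
apply: l2norm_le => // B _; rewrite expr1n.
rewrite (eq_bigr (fun x => if x == gunit G u then 1 else 0)); last first.
  move=> x _; case: eqP => [->|xu].
    by rewrite rnorm_unit_delta ?trepK// expr1n.
  by rewrite unit_delta_eq0 ?trepK// rnorm0 expr0n.
have [uB|uB] := boolP (gunit G u \in B).
  rewrite (big_fsetD1 (gunit G u))//= eqxx big1_fset ?addr0// => x.
  by rewrite !inE => /andP[/negbTE ->].
by rewrite big1_fset// => x xB _; case: eqP => // xu; rewrite -xu xB in uB.
Qed.

Lemma l2_unit_delta u : l2 u (unit_delta u).
Proof.
split; first exact: unit_delta_equivariant.
- move=> a au; apply: unit_delta_eq0 => aE; apply: au.
  by rewrite -tq_src aE gsrc_unit.
- by apply: le_lt_trans (l2norm_unit_delta u) _; rewrite ltry.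
Qed.

(** Only [x = q(a)] contributes, since [x^-1 q(a)] is a unit for no other [x], and there the second
    factor has modulus 1. *)
Lemma rnorm_conv_unit_delta f a : equivariant f ->
  rnorm (conv f (unit_delta (gsrc a)) a) = rnorm (f a).
Proof.
move=> ef; set u := gsrc a.
have qa x : grng x = grng a ->
    tq (gmul (ginv (trep S x)) a) = gmul (ginv x) (tq a).
  by move=> xa; rewrite tqM ?gsrcV ?grng_trep// tq_inv trepK.
rewrite /conv -(fsbig_widen [set tq a]) //=; last 2 first.
- by move=> _ -> /=; rewrite tq_rng.
- move=> x [/= xa xqa]; rewrite unit_delta_eq0 ?mulr0// qa// => E; apply: xqa.
  have : gmul x (gmul (ginv x) (tq a)) = tq a by rewrite gmulKVl// tq_rng.
  rewrite E => <-; rewrite -[X in gunit G X](_ : gsrc x = _) ?gmul1r//.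
  by have := congr1 (@grng X G) E; rewrite grng_unit grngM ?gsrcV ?tq_rng// grngV.
rewrite fsbig_set1 rnormM rnorm_trep// rnorm_unit_delta ?mulr1//.
by rewrite qa ?tq_rng// gmulVl tq_src.
Qed.

(** Apply the regular representation to the unit vector at the source of [a]: the value at [a] is
    one coordinate of the result. *)
Lemma rnorm_le_reduced_norm f (c : R) a : 0 <= c -> equivariant f ->
  (reduced_norm f <= c%:E)%E -> rnorm (f a) <= c.
Proof.
move=> c0 ef fc; set u := gsrc a.
have := l2norm_conv_le fc (l2_unit_delta u) (l2norm_unit_delta u).
move=> /(sum_le_l2norm (B := [fset tq a]%fset) c0).
rewrite big_seq_fset1 (rnorm_trep a) ?rnorm_conv_unit_delta//; last first.
  exact/conv_equivariant/unit_delta_equivariant.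
rewrite ler_sqr ?nnegrE ?rnorm_ge0//; apply => x; rewrite inE => /eqP ->.
by rewrite tq_src.
Qed.

(** The squared norm attached to the trace, by [gtrace_conv_finvol]; meaningful for finite
    support. *)
Definition l2sq f : R := \sum_(x \in [set: G]) rnorm (f (trep S x)) ^+ 2.

Lemma l2sqE (D : {fset G}) f : gsupp f `<=` [set` D] ->
  l2sq f = \sum_(x <- D) rnorm (f (trep S x)) ^+ 2.
Proof.
move=> fD; rewrite /l2sq -(fsbig_widen [set` D])//=.
  by rewrite fsbig_finite//= set_fsetK.
move=> x [_ /= xD]; have [->|fx] := eqVneq (f (trep S x)) 0.
  by rewrite rnorm0 expr0n.
by case: xD; exact: fD.
Qed.

Lemma gsupp_fset f : finite_set (gsupp f) ->
  exists D : {fset G}, gsupp f `<=` [set` D].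
Proof.
move=> ff; exists (fset_set (gsupp f)) => x fx /=.
by rewrite in_fset_set// inE.
Qed.

(** Finite supports allow all three convolutions to be summed over one finite set; sums with
    infinite support default to 0 and need not be additive. *)
Lemma convDl f g h : finite_set (gsupp f) -> finite_set (gsupp g) ->
  conv (f + g) h = conv f h + conv g h.
Proof.
move=> /gsupp_fset[D fD] /gsupp_fset[E gE]; apply/funext => a.
have fDE : gsupp f `<=` [set` (D `|` E)%fset].
  by move=> x /fD /= xD; rewrite /= inE xD.
have gDE : gsupp g `<=` [set` (D `|` E)%fset].
  by move=> x /gE /= xE; rewrite /= inE xE orbT.
rewrite -[RHS]/(conv f h a + conv g h a) !(@conv_sum _ _ _ S (D `|` E)%fset)//; last first.
  by apply: subset_trans (@gsuppD _ _ _ _ f g) _; rewrite subUset.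
by rewrite -big_split/=; apply: eq_bigr => x _; rewrite fctE mulrDl.
Qed.

(** Cauchy-Schwarz against a vector of norm at most 1. If [A] and [B] are the sums of squares of
    [F1] and [F2] and [p] is the inner product, then [A - 2 p^2 + p^2 B] is a sum of squares and
    [B <= 1]. *)
Lemma sum_mul_sqr_le (I : Type) (s : seq I) (P : pred I) (F1 F2 : I -> R) :
  \sum_(i <- s | P i) F2 i ^+ 2 <= 1 ->
  (\sum_(i <- s | P i) F1 i * F2 i) ^+ 2 <= \sum_(i <- s | P i) F1 i ^+ 2.
Proof.
move=> B1; set p := \sum_(i <- s | P i) F1 i * F2 i.
have : 0 <= \sum_(i <- s | P i) (F1 i - p * F2 i) ^+ 2.
  by apply: sumr_ge0 => i _; exact: sqr_ge0.
rewrite (eq_bigr (fun i => F1 i ^+ 2 + (- (2 * p) * (F1 i * F2 i) + p ^+ 2 * F2 i ^+ 2))).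
  rewrite !big_split/= -!mulr_sumr -/p.
  have := sqr_ge0 p.
  by move: B1; move: (\sum_(i <- s | P i) F2 i ^+ 2) (\sum_(i <- s | P i) F1 i ^+ 2) => B A; nra.
by move=> i _; ring.
Qed.

(** Cauchy-Schwarz: [x |-> x^-1 q(a)] is injective on the arrows with the range of [a], so the
    second factors are distinct coordinates of [h] over the source of [a]. *)
Lemma rnorm_conv_le f h a : finite_set (gsupp f) -> equivariant h ->
  (l2norm (gsrc a) h <= 1)%E -> rnorm (conv f h a) ^+ 2 <= l2sq f.
Proof.
move=> /gsupp_fset[D fD] eh h1; rewrite (conv_sum _ _ fD) (l2sqE fD).
rewrite big_fset_condE; set E := [fset _ in D | _]%fset.
have ED : \sum_(x <- E) rnorm (f (trep S x)) ^+ 2 <=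
    \sum_(x <- D) rnorm (f (trep S x)) ^+ 2.
  rewrite -big_fset_condE [leRHS](bigID (fun x => `[<grng x = grng a>]))/= lerDl.
  by apply: sumr_ge0 => x _; exact: sqr_ge0.
apply: le_trans ED.
set F2 := fun x => rnorm (h (gmul (ginv (trep S x)) a)).
apply: (@le_trans _ _ ((\sum_(x <- E) rnorm (f (trep S x)) * F2 x) ^+ 2)).
  rewrite lerXn2r ?nnegrE ?rnorm_ge0//.
    by apply: sumr_ge0 => x _; rewrite mulr_ge0 ?rnorm_ge0.
  rewrite (le_trans (rnorm_sum _ _ _))//.
  by apply: ler_sum => x _; rewrite rnormM.
apply: sum_mul_sqr_le.
have Ea x : x \in E -> grng x = grng a.
  by rewrite !inE/= => /andP[_ /asboolP].
pose B := [fset gmul (ginv x) (tq a) | x in E]%fset.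
have <- : \sum_(b <- B) rnorm (h (trep S b)) ^+ 2 = \sum_(x <- E) F2 x ^+ 2.
  rewrite big_imfset/=; last first.
    move=> x y /Ea xa /Ea ya xy; rewrite -(ginvK x) -(ginvK y); congr ginv.
    have := congr1 (fun z => gmul z (ginv (tq a))) xy.
    rewrite /= -!gmulA ?gsrcV ?tq_rng ?grngV// gmulV tq_rng.
    by rewrite -{1}xa -ya -!gsrcV !gmul1r.
  apply: eq_big_seq => x /Ea xa; rewrite /F2 -(rnorm_trep (gmul _ a) eh).
  by rewrite tqM ?gsrcV ?grng_trep// tq_inv trepK.
rewrite -[leRHS](expr1n _ 2); apply: (@sum_le_l2norm (gsrc a)) => // b.
by move=> /imfsetP[x /= /Ea xa ->]; rewrite gsrcM ?gsrcV ?tq_rng// tq_src.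
Qed.

(* lambda(f) = lambda(f - g) + lambda(g), and lambda(g) h is pointwise small when
   the l2-norm of g is; the l2-norm of lambda(f) h is computed on finite sets. *)
Lemma reduced_norm_le f (d : R) : 0 < d -> finite_set (gsupp f) ->
  (forall e : R, 0 < e -> exists g,
     [/\ finite_set (gsupp g), (reduced_norm (f - g)%R <= d%:E)%E & l2sq g <= e]) ->
  (reduced_norm f <= (2 * d)%R%:E)%E.
Proof.
move=> d0 ff fg; apply: ge_ereal_sup => _ [->|[u _ <-]].
  by rewrite lee_fin mulr_ge0// ltW.
apply: ge_ereal_sup => _ [h [hu h1] <-].
have [eh _ _] := hu.
apply: l2norm_le => [|B Bu]; first by rewrite mulr_ge0// ltW.
pose n : R := (#|` B|)%:R.
have n0 : 0 <= n by rewrite ler0n.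
(* [g] may depend on [B]: with this bound the [n] coordinates over [B] contribute at most [d^2]
   through [g]. Doubling both squares then gives [4 d^2]. *)
have [g [fing fgd ge]] := fg (d ^+ 2 / (n + 1)) ltac:(by rewrite divr_gt0 ?exprn_gt0// ltr_wpDl).
have finfg : finite_set (gsupp (f - g)).
  apply: (@sub_finite_set _ _ (gsupp f `|` gsupp g)); last by rewrite finite_setU.
  rewrite -scaleN1r; apply: subset_trans (@gsuppD _ _ _ _ _ _) _.
  by apply: setUS; exact: gsuppZ.
have E x : rnorm (conv f h (trep S x)) ^+ 2 <=
    2 * rnorm (conv (f - g) h (trep S x)) ^+ 2 + 2 * rnorm (conv g h (trep S x)) ^+ 2.
  have -> : conv f h (trep S x) = conv (f - g) h (trep S x) + conv g h (trep S x).
    by rewrite -[RHS]/((conv (f - g) h + conv g h) (trep S x)) -convDl// subrK.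
  move: (conv (f - g) h _) (conv g h _) => a b.
  have := rnormD a b; have := rnorm_ge0 (a + b).
  move: (rnorm (a + b)) (rnorm a) (rnorm b) => p q r p0 pqr.
  have pqr2 : p ^+ 2 <= (q + r) ^+ 2 by rewrite lerXn2r// nnegrE// (le_trans p0).
  by have := sqr_ge0 (q - r); nra.
have : forall x, x \in B -> rnorm (conv g h (trep S x)) ^+ 2 <= l2sq g.
  by move=> x xB; apply: rnorm_conv_le => //; rewrite gsrc_trep (Bu x xB).
move: (l2sq g) ge => M Me gM.
apply: (@le_trans _ _ (2 * \sum_(x <- B) rnorm (conv (f - g) h (trep S x)) ^+ 2 +
    2 * \sum_(x <- B) M)).
  rewrite !mulr_sumr -big_split/= big_seq [leRHS]big_seq.
  by apply: ler_sum => x xB; rewrite (le_trans (E x))// lerD2l ler_pM2l// gM.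
have E1 := sum_le_l2norm (ltW d0) (l2norm_conv_le fgd hu h1) Bu.
have E2 : \sum_(x <- B) M <= d ^+ 2.
  rewrite big_const_seq count_predT iter_addr_0 -mulr_natr -/n.
  rewrite (le_trans (ler_wpM2r n0 Me))//.
  by rewrite mulrAC ler_pdivrMr ?ltr_wpDl// ler_wpM2l ?sqr_ge0// lerDl.
by move: E1 E2; lra.
Qed.

(** * The trace over a finite unit space *)

Definition gtrace f : R := \sum_(u \in [set: X]) complex.Re (f (gunit S u)).

Section Trace.
Hypothesis fX : finite_set [set: X].

Lemma gtraceE f : gtrace f = \sum_(u <- fset_set [set: X]) complex.Re (f (gunit S u)).
Proof. by rewrite /gtrace fsbig_finite. Qed.

Lemma gtraceD f g : gtrace (f + g) = gtrace f + gtrace g.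
Proof.
rewrite !gtraceE -big_split; apply: eq_bigr => u _.
by rewrite fctE raddfD.
Qed.

Lemma gtrace_sum (I : Type) (s : seq I) (F : I -> S -> R[i]) :
  gtrace (\sum_(i <- s) F i) = \sum_(i <- s) gtrace (F i).
Proof.
elim: s => [|i s IH]; last by rewrite !big_cons gtraceD IH.
by rewrite !big_nil gtraceE big1.
Qed.

Lemma gtraceN f : gtrace (- f) = - gtrace f.
Proof.
apply/eqP; rewrite -addr_eq0 -gtraceD addNr gtraceE.
by apply/eqP; apply: big1.
Qed.

(** Each value at a unit is bounded by the reduced norm, so the trace is bounded by the number of
    units. *)
Lemma gtrace_le f (c : R) : 0 <= c -> equivariant f ->
  (reduced_norm f <= c%:E)%E -> `|gtrace f| <= (#|` fset_set [set: X]|)%:R * c.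
Proof.
move=> c0 ef fc; rewrite gtraceE (le_trans (ler_norm_sum _ _ _))//.
rewrite mulr_natl card_fset_sum1 -sumrMnr.
apply: ler_sum => u _; rewrite (le_trans (Re_le_rnorm _))//.
exact: rnorm_le_reduced_norm fc.
Qed.

(** At a unit [u] the convolution is the sum of [|f|^2] over the arrows with range [u], and these
    range fibres partition [G]. *)
Lemma gtrace_conv_finvol f : finite_set (gsupp f) ->
  gtrace (conv f (finvol f)) = l2sq f.
Proof.
move=> /gsupp_fset[D fD]; rewrite gtraceE (l2sqE fD).
have E u : complex.Re (conv f (finvol f) (gunit S u)) =
    \sum_(x <- D | `[<grng x = u>]) rnorm (f (trep S x)) ^+ 2.
  rewrite (conv_sum _ _ fD) grng_unit raddf_sum.
  apply: eq_bigr => x /asboolP xu.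
  rewrite /finvol ginvM ?gsrcV ?grng_unit ?grng_trep// ginvK ginv_unit.
  by rewrite -xu -(grng_trep S x) gmul1l mul_conj_rnorm.
rewrite (eq_bigr _ (fun u _ => E u)).
rewrite (exchange_big_dep xpredT)//=; apply: eq_bigr => x _.
rewrite (eq_bigl (fun u => u == grng x)); last first.
  by move=> u /=; rewrite eq_sym; apply/asboolP/eqP.
by rewrite (fbig_pred1_inj _ (k := id))// in_fset_set// inE.
Qed.

End Trace.

(** Inversion permutes [G]. With [gtrace_conv_finvol] this yields the trace property: [f^* f] and
    [f f^*] have the same trace. *)
Lemma l2sq_finvol f : equivariant f -> l2sq (finvol f) = l2sq f.
Proof.
move=> ef; rewrite /l2sq [RHS](reindex_fsbigT (@ginv X G)); last first.
  by exists (@ginv X G); exact: ginvK.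
apply: eq_fsbigr => x _; rewrite /finvol rnorm_conj; congr (_ ^+ 2).
by apply: rnorm_equivariant => //; rewrite tq_inv !trepK.
Qed.

Lemma finvolK f : finvol (finvol f) = f.
Proof. by apply/funext => a; rewrite /finvol ginvK conjCK. Qed.

End NormEstimates.

(** * Approximation in the reduced algebra *)

Section CStarNorm.
Context (R : realType) (A : cstarAlgType R).
Implicit Types a b x y p q : A.

Lemma rnorm_amul a b : rnorm (amul a b) <= rnorm a * rnorm b.
Proof. by rewrite -lecR rmorphM/= -!rnormE ler_norm_amul. Qed.

Lemma rnorm_star_mul a : rnorm (amul (astar a) a) = rnorm a ^+ 2.
Proof.
have := cstar_identity a; rewrite !rnormE -rmorphXn.
by move=> /(congr1 (@complex.Re R)).
Qed.

(** The identity for [b^* b] gives [|b|^2 <= |b^*| |b|]; use it for [a] and for its adjoint. *)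
Lemma rnorm_astar a : rnorm (astar a) = rnorm a.
Proof.
suff le b : rnorm b <= rnorm (astar b).
  by apply/eqP; rewrite eq_le le -{2}(astarK a) le.
have [->|b0] := eqVneq (rnorm b) 0; first exact: rnorm_ge0.
rewrite -(@ler_pM2r _ (rnorm b)) ?lt0r ?b0 ?rnorm_ge0//.
by rewrite -expr2 -rnorm_star_mul rnorm_amul.
Qed.

Lemma amulBl a b x : amul (a - b) x = amul a x - amul b x.
Proof. by rewrite -(scaleN1r b) amulDl amulZl scaleN1r. Qed.

Lemma amulBr a x y : amul a (x - y) = amul a x - amul a y.
Proof. by rewrite -(scaleN1r y) amulDr amulZr scaleN1r. Qed.

Lemma astarB a b : astar (a - b) = astar a - astar b.
Proof. by rewrite -(scaleN1r b) astarD astarZ rmorphN1 scaleN1r. Qed.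

(** In [(x - a) y + a (y - b)] the factor [y] has norm at most [1 + e <= 2], whence the constant
    [2 + 1]. *)
Lemma rnorm_amulB (e : R) a b x y : e <= 1 -> rnorm a <= 1 -> rnorm b <= 1 ->
  rnorm (x - a) <= e -> rnorm (y - b) <= e -> rnorm (amul x y - amul a b) <= 3 * e.
Proof.
move=> e1 a1 b1 xa yb.
have -> : amul x y - amul a b = amul (x - a) y + amul a (y - b).
  by rewrite amulBl amulBr addrA subrK.
have y1 : rnorm y <= e + 1.
  by rewrite -(subrK b y) (le_trans (rnormD _ _))// lerD.
rewrite (le_trans (rnormD _ _))//.
have := rnorm_amul (x - a) y; have := rnorm_amul a (y - b).
have := rnorm_ge0 y; have := rnorm_ge0 (x - a).
have := rnorm_ge0 a; have := rnorm_ge0 (y - b); nra.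
Qed.

Lemma rnorm_projection_le1 q : astar q = q -> amul q q = q -> rnorm q <= 1.
Proof.
move=> qs qq; have := rnorm_star_mul q; rewrite qs qq.
have := rnorm_ge0 q; nra.
Qed.

End CStarNorm.

(** * Faithfulness of the trace and its consequence in the completed algebra *)

Section ReducedAlgebra.
Context (R : realType) (X : topologicalType) (G : topGroupoid X).
Variables (S : twist R G) (A : cstarAlgType R) (j : (S -> R[i]) -> A).
Hypothesis dG : forall x : G, open [set x].
Hypothesis fX : finite_set [set: X].
Hypothesis jD : forall f g, Cc f -> Cc g -> j (f + g) = j f + j g.
Hypothesis jZ : forall (c : R[i]) f, Cc f -> j (c *: f) = c *: j f.
Hypothesis jM : forall f g, Cc f -> Cc g -> j (conv f g) = amul (j f) (j g).
Hypothesis jV : forall f, Cc f -> j (finvol f) = astar (j f).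
Hypothesis jnorm : forall f, Cc f -> (rnorm (j f))%:E = reduced_norm f.
Hypothesis jdense : dense (j @` @Cc _ _ _ S).
Implicit Types (f g : S -> R[i]) (a p : A).

Lemma CcB f g : Cc f -> Cc g -> Cc (f - g).
Proof. by move=> cf cg; rewrite -scaleN1r; apply: CcD => //; exact: CcZ. Qed.

Lemma jB f g : Cc f -> Cc g -> j (f - g) = j f - j g.
Proof. by move=> cf cg; rewrite -scaleN1r jD//; [rewrite jZ// scaleN1r|exact: CcZ]. Qed.

Lemma Cc0 : Cc (0 : S -> R[i]).
Proof.
apply/Cc_finite => //; split; first by move=> z a _; exact/esym/mulr0.
by rewrite (_ : gsupp _ = set0)// -subset0 => x; rewrite /gsupp/= eqxx.
Qed.

Lemma Cc_j_sum (n : nat) (F : nat -> S -> R[i]) : (forall i, Cc (F i)) ->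
  Cc (\sum_(i < n) F i) /\ j (\sum_(i < n) F i) = \sum_(i < n) j (F i).
Proof.
move=> cF; elim: n => [|n [IH1 IH2]].
  rewrite !big_ord0; split; first exact: Cc0.
  by rewrite -(scale0r (0 : S -> R[i])) jZ ?scale0r//; exact: Cc0.
rewrite !big_ord_recr/= jD// IH2; split => //; exact: CcD.
Qed.

Lemma j_approx a (e : R) : 0 < e -> exists2 f, Cc f & rnorm (j f - a) <= e.
Proof.
move=> e0.
have [|b [/interior_subset ab [f cf fb]]] := jdense (O := (ball a e%:C)^°) _ (open_interior _).
  by exists a; apply: nbhsx_ballx; rewrite ltcR.
exists f => //; rewrite fb rnormB ltW//.
by move: ab; rewrite -ball_normE/= rnormE ltcR.
Qed.

(** Faithfulness of the trace. Otherwise [a] has, within [d], functions [g] of arbitrarily small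
    l2-norm. Any [f] within [d] of [a] is within [2 d] of all of them, so [reduced_norm_le] bounds
    its norm by [4 d]. *)
Lemma l2sq_lower_bound a : a != 0 -> exists c d : R, [/\ 0 < c, 0 < d &
  forall g, Cc g -> rnorm (j g - a) <= d -> c <= l2sq g].
Proof.
(* The contradiction will be [|a| <= 5 d]. *)
move=> a0; set d := rnorm a / 8.
have na0 : 0 < rnorm a.
  by rewrite lt0r rnorm_ge0 andbT; apply: contra_neq a0; exact: rnorm0_eq0.
have d0 : 0 < d by rewrite divr_gt0.
apply: contrapT => bad.
have approx (c : R) : 0 < c -> exists g, [/\ Cc g, rnorm (j g - a) <= d & l2sq g <= c].
  move=> c0; apply: contrapT => Ng; apply: bad; exists c, d; split=> // g cg ga.
  by rewrite leNgt; apply/negP => gc; apply: Ng; exists g; split=> //; exact: ltW.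
have [f [cf fa _]] := approx 1 ltr01.
have : (reduced_norm f <= (2 * (2 * d))%R%:E)%E.
  apply: reduced_norm_le; first by rewrite mulr_gt0.
    by case/(Cc_finite dG) : cf.
  move=> e /approx[g [cg ga ge]]; exists g; split=> //.
    by case/(Cc_finite dG) : cg.
  rewrite -jnorm; last exact: CcB.
  rewrite lee_fin jB// -(subrKA a) (le_trans (rnormD _ _))// (rnormB a).
  by rewrite mulr2n mulrDl mul1r lerD.
rewrite -jnorm// lee_fin => jf.
have : rnorm a <= rnorm (a - j f) + rnorm (j f) by rewrite -{1}(subrK (j f) a) rnormD.
by rewrite rnormB; move: fa jf na0; rewrite /d; lra.
Qed.

Lemma gtrace_le_rnorm f : Cc f ->
  `|gtrace f| <= (#|` fset_set [set: X]|)%:R * rnorm (j f).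
Proof.
move=> cf; apply: gtrace_le => //; first exact: rnorm_ge0.
  by case/(Cc_finite dG) : cf.
by rewrite jnorm.
Qed.

Lemma gtrace_star_mul f : Cc f -> gtrace (conv (finvol f) f) = l2sq f.
Proof.
case/(Cc_finite dG) => ef ff; rewrite -(l2sq_finvol ef) -{2}(finvolK f).
apply: gtrace_conv_finvol => //.
by case/(Cc_finite dG) : (Cc_finvol dG (iffRL (Cc_finite dG f) (conj ef ff))).
Qed.

Lemma gtrace_mul_star f : Cc f -> gtrace (conv f (finvol f)) = l2sq f.
Proof. by case/(Cc_finite dG) => ef ff; exact: gtrace_conv_finvol. Qed.

Lemma isometric_family_bounded a0 : a0 != 0 -> rnorm a0 <= 1 -> exists K : R,
  forall (n : nat) (a : nat -> A),
    (forall i, amul (astar (a i)) (a i) = amul (astar a0) a0) ->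
    rnorm (\sum_(i < n) amul (a i) (astar (a i))) <= 1 -> n%:R <= K.
Proof.
move=> a0n0 a01; have [c [d [c0 d0 low]]] := l2sq_lower_bound a0n0.
set C : R := (#|` fset_set [set: X]|)%:R.
have C0 : 0 <= C by rewrite ler0n.
(* The three bounds serve [l2sq_lower_bound], [rnorm_amulB] and the absorption of errors; [C + 1]
   keeps the denominator positive if [X] is empty. *)
pose e := Num.min d (Num.min 1 (c / (12 * (C + 1)))).
have D0 : 0 < 12 * (C + 1) by lra.
have e0 : 0 < e by rewrite !lt_min d0 ltr01 divr_gt0.
have ed : e <= d by rewrite !ge_min lexx.
have e1 : e <= 1 by rewrite !ge_min lexx orbT.
have eC : 12 * (C * e) <= c.
  have : e <= c / (12 * (C + 1)) by rewrite !ge_min lexx !orbT.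
  by rewrite ler_pdivlMr// => E; clearbody e C; nra.
have [f0 cf0 fa0] := j_approx a0 e0.
(* The end result is [n c / 2 <= C (1 + 3 n e) <= C + n c / 4]. *)
exists (4 * C / c) => n a aE sum1.
have a1 i : rnorm (a i) <= 1.
  have := rnorm_star_mul (a i); rewrite aE rnorm_star_mul.
  by have := rnorm_ge0 a0; have := rnorm_ge0 (a i); nra.
have /choice[f fP] : forall i, exists f, Cc f /\ rnorm (j f - a i) <= e.
  by move=> i; have [g cg ga] := j_approx (a i) e0; exists g.
have cf i : Cc (f i) by have [] := fP i.
have fa i : rnorm (j (f i) - a i) <= e by have [] := fP i.
have starP g b : rnorm (j g - b) <= e -> rnorm (astar (j g) - astar b) <= e.
  by rewrite -astarB rnorm_astar.
(* The lower bound [c] is known for [f0] only; it passes to [f i] because [a i] and [a0] have the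
   same [a^* a], at a cost of at most [6 C e <= c / 2]. *)
have fi i : c / 2 <= l2sq (f i).
  have cfi := Cc_conv dG (Cc_finvol dG (cf i)) (cf i).
  have cf00 := Cc_conv dG (Cc_finvol dG cf0) cf0.
  have := gtrace_le_rnorm (CcB cf00 cfi); rewrite -/C.
  rewrite gtraceD// gtraceN// !gtrace_star_mul// jB// !jM ?jV//; try exact: Cc_finvol.
  have E1 : rnorm (amul (astar (j f0)) (j f0) - amul (astar a0) a0) <= 3 * e.
    by apply: rnorm_amulB; rewrite ?rnorm_astar//; exact: starP.
  have E2 : rnorm (amul (astar (j (f i))) (j (f i)) - amul (astar a0) a0) <= 3 * e.
    by rewrite -(aE i); apply: rnorm_amulB; rewrite ?rnorm_astar//; exact: starP.
  have E3 : rnorm (amul (astar (j f0)) (j f0) - amul (astar (j (f i))) (j (f i))) <= 6 * e.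
    rewrite -(subrKA (amul (astar a0) a0)) (le_trans (rnormD _ _))// rnormB.
    by rewrite [X in X + _]rnormB; move: E1 E2; rewrite [in X in _ -> X -> _]rnormB; lra.
  have := low _ cf0 (le_trans fa0 ed).
  have := ler_wpM2l C0 E3.
  by move=> E4 E5 /ler_normlP[_ E6]; lra.
have [cF jF] := Cc_j_sum n (F := fun i => conv (f i) (finvol (f i)))
  (fun i => Cc_conv dG (cf i) (Cc_finvol dG (cf i))).
have := gtrace_le_rnorm cF; rewrite jF gtrace_sum//.
under eq_bigr do rewrite gtrace_mul_star//.
have S1 : n%:R * (c / 2) <= \sum_(i < n) l2sq (f i).
  rewrite mulr_natl -[X in _ *+ X](card_ord n) -sumr_const.
  by apply: ler_sum => i _; exact: fi.
(* Each of the [n] terms moves by at most [3 e] when [a i] is replaced by its approximant. *)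
have S2 : rnorm (\sum_(i < n) j (conv (f i) (finvol (f i)))) <= 1 + n%:R * (3 * e).
  rewrite -[X in rnorm X](subrK (\sum_(i < n) amul (a i) (astar (a i)))).
  rewrite addrC (le_trans (rnormD _ _))// lerD// -sumrB (le_trans (rnorm_sum _ _ _))//.
  rewrite mulr_natl -[X in _ *+ X](card_ord n) -sumr_const.
  apply: ler_sum => i _; rewrite jM ?jV//; last exact: Cc_finvol.
  by apply: rnorm_amulB; rewrite ?rnorm_astar//; exact: starP.
move=> /ler_normlP[_]; rewrite -/C => S3.
have S4 := ler_wpM2l C0 S2.
have n0 : 0 <= n%:R :> R by [].
have S5 := ler_wpM2l n0 eC.
rewrite ler_pdivlMr//.
have := le_trans S1 (le_trans S3 S4).
by move: S5; move: (n%:R) => m; lra.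
Qed.

End ReducedAlgebra.

(** * Finite rank operators *)

Section RankOne.
Context (R : realType) (H : hilbertType R).
Implicit Types x y z w : H.

Lemma rank_one_subproof x y :
  (fun z => hdot z y *: x) \in @bounded_linear R H.
Proof.
apply/bounded_linearP; split.
  by move=> c z w; rewrite hdotDl hdotZl scalerDl scalerA.
exists (rnorm y * rnorm x) => z; rewrite normrZ (le_trans (ler_wpM2r _ (norm_hdot_le z y)))//.
by rewrite rmorphM/= -!rnormE -mulrA mulrC.
Qed.

Definition rank_one x y : 'B(H) := BoundedOp (rank_one_subproof x y).

Lemma rank_oneE x y z : rank_one x y z = hdot z y *: x. Proof. by []. Qed.

Lemma adjoint_rank_one x y : astar (rank_one x y) = rank_one y x.
Proof.
apply: adjoint_unique => z w.
by rewrite !rank_oneE hdotZl hdotZr -hdotC mulrC.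
Qed.

Lemma amul_rank_one x y z w :
  amul (rank_one x y) (rank_one z w) = hdot z y *: rank_one x w.
Proof.
apply: bop_ext => t; rewrite -[LHS]/(hdot (hdot t w *: z) y *: x) hdotZl.
by rewrite bop_scaleE rank_oneE scalerA mulrC.
Qed.

(** All vectors of the sequence have norm 1, even past [n], because [isometric_family_bounded] puts
    a condition on every index. *)
Definition orthonormal (e : nat -> H) (n : nat) :=
  (forall i, hdot (e i) (e i) = 1) /\
  forall i k, (i < n)%N -> (k < n)%N -> i != k -> hdot (e i) (e k) = 0.

Lemma hdotxx_rnorm x : hdot x x = (rnorm x ^+ 2)%:C.
Proof. by rewrite hdotxx rnormE rmorphXn. Qed.

Lemma normalize x : x != 0 -> hdot ((rnorm x)^-1%:C *: x) ((rnorm x)^-1%:C *: x) = 1.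
Proof.
move=> x0; have nx : rnorm x != 0 by apply: contra_neq x0; exact: rnorm0_eq0.
rewrite hdotZl hdotZr hdotxx_rnorm conjc_real -!rmorphM/=.
rewrite [X in X%:C](_ : _ = 1)//.
by field.
Qed.

Lemma hdot_suml I (s : seq I) (F : I -> H) y :
  hdot (\sum_(i <- s) F i) y = \sum_(i <- s) hdot (F i) y.
Proof.
elim: s => [|i s IH]; last by rewrite !big_cons hdotDl IH.
by rewrite !big_nil -(scale0r (0 : H)) hdotZl mul0r.
Qed.

Lemma infinite_dimensional_residue n (e : 'I_n -> H) : infinite_dimensional H ->
  exists v, forall c : 'I_n -> R[i], v - \sum_i c i *: e i != 0.
Proof.
move=> iH; apply: contrapT => Nv; apply: iH; exists n, e => v.
apply: contrapT => Nc; apply: Nv; exists v => c.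
by rewrite subr_eq0; apply/eqP => vc; apply: Nc; exists c.
Qed.

(** Gram-Schmidt: some vector has a nonzero residue modulo the span of the first [n], and this
    residue, normalised, is put at index [n]. *)
Lemma orthonormal_exists n : infinite_dimensional H ->
  exists e, orthonormal e n.
Proof.
move=> iH; elim: n => [|n [e [e1 eo]]].
  (* The residue modulo the empty family is just a nonzero vector; repeating it gives unit vectors
     at all indices. *)
  have [v /(_ (fun=> 0))] := infinite_dimensional_residue (fun i : 'I_0 => 0) iH.
  rewrite big_ord0 subr0 => v0.
  by exists (fun=> (rnorm v)^-1%:C *: v); split => // i; exact: normalize.
(* These coefficients make the residue orthogonal to the [e i]. *)
have [v /(_ (fun i => hdot v (e i)))] :=
  infinite_dimensional_residue (fun i : 'I_n => e i) iH.
set w := v - _ => w0.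
have we k : (k < n)%N -> hdot w (e k) = 0.
  move=> kn; rewrite /w -scaleN1r hdotDl hdotZl hdot_suml.
  rewrite (bigD1 (Ordinal kn))//= hdotZl e1 mulr1 big1 ?addr0 ?mulN1r ?subrr//.
  by move=> i ik; rewrite hdotZl eo ?mulr0.
pose w' := (rnorm w)^-1%:C *: w.
have w'e k : (k < n)%N -> hdot w' (e k) = 0.
  by move=> kn; rewrite hdotZl we// mulr0.
exists (fun i => if i == n then w' else e i); split.
  by move=> i; case: eqP => // _; exact: normalize.
move=> i k; rewrite !ltnS [(i <= n)%N]leq_eqVlt [(k <= n)%N]leq_eqVlt.
have [->|/= _] := eqVneq i n; have [->|/= _] := eqVneq k n; rewrite ?eqxx//=.
- by move=> _ kn _; exact: w'e.
- by move=> i0 _ _; rewrite hdotC w'e// conjc0.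
- exact: eo.
Qed.

Lemma bop_sumE (n : nat) (F : 'I_n -> 'B(H)) x : (\sum_i F i) x = \sum_i F i x.
Proof.
exact: (big_morph (fun T : 'B(H) => T x) (fun S T => bop_addE S T x) erefl).
Qed.

Lemma orthonormal_projection (e : nat -> H) n : orthonormal e n ->
  let Q := \sum_(i < n) rank_one (e i) (e i) in astar Q = Q /\ amul Q Q = Q.
Proof.
move=> [e1 eo] Q; split.
  rewrite /Q (big_morph _ (@astarD _ _) (_ : astar 0 = 0)).
    by apply: eq_bigr => i _; rewrite adjoint_rank_one.
  by have := astarZ 0 (0 : 'B(H)); rewrite scale0r conjC0 scale0r.
apply: bop_ext => x; rewrite -[LHS]/(Q (Q x)) /Q !bop_sumE.
(* It remains to see that [Q x] and [x] have the same coefficient on [e i]. *)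
apply: eq_bigr => i _; rewrite !rank_oneE hdot_suml; congr (_ *: _).
rewrite (bigD1 i)//= hdotZl e1 mulr1 big1 ?addr0// => k ki.
by rewrite hdotZl eo ?mulr0.
Qed.

End RankOne.

(** * Equivalent rank one projections in B(H) against the bound from the trace *)

Unset Implicit Arguments.

Theorem corollary3p6 (R : realType) (H : hilbertType R)
    (X : topologicalType) (G : topGroupoid X) (S : twist R G)
    (A : cstarAlgType R) :
  infinite_dimensional H ->
  locally_compact [set: G] -> hausdorff_space G -> etale G ->
  is_reduced_cstar_algebra S A ->
  star_isomorphic 'B(H) A ->
  ~ finite_set [set: X].
Proof.
move=> iH _ hG eG [j [[jD jZ] jM jV jnorm jdense]] [phi [phi_bij phiD phiZ phiM phiV]] fX.
have dG := etale_discrete (finite_hausdorff_discrete (hausdorff_units hG) fX) eG.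
have phi0 : phi 0 = 0 by have := phiZ 0 0; rewrite !scale0r.
have phi_sum n (F : 'I_n -> 'B(H)) : phi (\sum_i F i) = \sum_i phi (F i).
  exact: (big_morph phi phiD phi0).
(* A single unit vector [h] is wanted here. *)
have [e [e1 _]] := orthonormal_exists 1 iH; set h := e 0%N in e1.
have h1 : hdot h h = 1 by exact: e1.
pose p := rank_one h h.
have ps : astar p = p by rewrite adjoint_rank_one.
have pp : amul p p = p by rewrite amul_rank_one h1 scale1r.
have p0 : phi p != 0.
  rewrite -phi0 (inj_eq (bij_inj phi_bij)); apply/eqP => pE.
  have : hdot ((0 *: p : 'B(H)) h) h = 1 by rewrite scale0r -pE rank_oneE h1 scale1r.
  by rewrite bop_scaleE hdotZl mul0r => /esym/eqP; rewrite oner_eq0.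
have p1 : rnorm (phi p) <= 1.
  by apply: rnorm_projection_le1; rewrite -?phiV -?phiM ?ps ?pp.
have [K KP] := isometric_family_bounded dG fX jD jZ jM jV jnorm jdense p0 p1.
have [n Kn] : exists n : nat, K < n%:R.
  by exists (Num.bound `|K|); rewrite (le_lt_trans (ler_norm K))// archi_boundP.
have [f fo] := orthonormal_exists n iH.
suff : n%:R <= K by rewrite leNgt Kn.
(* The operator [rank_one (f i) h] is a partial isometry from the line of [h] to that of [f i]: it
   gives [p] on one side and the projection onto [f i] on the other. The latter add up to a
   projection, of norm at most 1. *)
apply: (KP n (fun i => phi (rank_one (f i) h))).
  move=> i; rewrite -!phiV -!phiM ps pp adjoint_rank_one amul_rank_one.
  by case: fo => -> _; rewrite scale1r.
rewrite (eq_bigr (fun i : 'I_n => phi (rank_one (f i) (f i)))); last first.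
  by move=> i _; rewrite -phiV -phiM adjoint_rank_one amul_rank_one h1 scale1r.
rewrite -phi_sum; have [Qs QQ] := orthonormal_projection fo.
by apply: rnorm_projection_le1; rewrite -?phiV -?phiM ?Qs ?QQ.
Qed.
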